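(* Consider the double tetrahedron $\mathrm{DT}$, with metrics written in the coordinates $(\ell_{12},\ell_{13},\ell_{14},\ell_{23},\ell_{24},\ell_{34})$. For $k>0$ call the metric with all six lengths equal to $k$ an equal length metric. Then: (1) Every equal length metric is both an $\mathcal{L}$-Einstein metric and a $\mathcal{V}$-Einstein metric. (2) At the equal length metric with edge lengths $k$, the $6\times 6$ Hessian matrices (second partial derivatives with respect to the edge lengths) of $\mathcal{LEHR}$ and of $\mathcal{VEHR}$ both have the following eigenspaces and eigenvalues: - $V_{\lambda_1}=\mathrm{span}\{(1,0,0,0,0,-1),\,(0,1,0,0,-1,0),\,(0,0,1,-1,0,0)\}$, with eigenvalue $\lambda_1^{\mathcal{LEHR}}=\frac{2\sqrt2}{9}k^{-2}$ for $\mathcal{LEHR}$ and $\lambda_1^{\mathcal{VEHR}}=2^{7/6}3^{-2/3}k^{-2}\left(2^{3/2}+9\pi-9\arccos\left(\tfrac13\right)\right)$ for $\mathcal{VEHR}$; - $V_{\lambda_2}=\mathrm{span}\{(0,1,-1,-1,1,0),\,(1,-\tfrac12,-\tfrac12,-\tfrac12,-\tfrac12,1)\}$, with eigenvalue $\lambda_2^{\mathcal{LEHR}}=-\frac{2\sqrt2}{3}k^{-2}$ for $\mathcal{LEHR}$ and $\lambda_2^{\mathcal{VEHR}}=2^{7/6}3^{1/3}k^{-2}\left(7\pi-2^{3/2}-7\arccos\left(\tfrac13\right)\right)$ for $\mathcal{VEHR}$; - $V_0=\mathrm{span}\{(1,1,1,1,1,1)\}$, with eigenvalue $0$ for both. (3)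 The equal length metrics are the only critical points of $\mathcal{LEHR}$ on $\mathfrak{met}(\mathrm{DT})$, hence the only $\mathcal{L}$-Einstein metrics, and they are saddle points of $\mathcal{LEHR}$. (4) The equal length metrics are local minima of $\mathcal{VEHR}$ on $\mathfrak{met}(\mathrm{DT})$.
   Context: The double tetrahedron $\mathrm{DT}$ is the triangulation of $S^3$ obtained by gluing two congruent Euclidean tetrahedra along corresponding boundary faces. It has vertices $1,2,3,4$ and six edges $ij$. A metric is a vector $\ell=(\ell_{12},\ell_{13},\ell_{14},\ell_{23},\ell_{24},\ell_{34})$ of positive numbers that are the edge lengths of a nondegenerate Euclidean tetrahedron (the generating tetrahedron); $\mathfrak{met}(\mathrm{DT})\subset\mathbb{R}^6$ is the open set of all metrics. Let $\beta_{ij}\in(0,\pi)$ be the dihedral angle of the generating tetrahedron at edge $ij$, and define $$K_{ij}=(2\pi-2\beta_{ij})\ell_{ij},\qquad \mathcal{EHR}=\sum_{ij}K_{ij},\qquad \mathcal{L}=\sum_{ij}\ell_{ij},$$ $\mathcal{V}=$ twice the volume of the generating tetrahedron, $\mathcal{LEHR}=\mathcal{EHR}/\mathcal{L}$, $\mathcal{VEHR}=\mathcal{EHR}/\mathcal{V}^{1/3}$. A metric is $\mathcal{L}$-Einstein if there is $\lambda\in\mathbb{R}$ with $K_e=\lambda\ell_e$ for all edges $e$. It is $\mathcal{V}$-Einstein if there is $\lambda\in\mathbb{R}$ with $K_e=\lambda\,\ell_e\frac{\partial\mathcal{V}}{\partial\ell_e}$ for all edges $e$. (These are the critical points of $\mathcal{LEHR}$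 and $\mathcal{VEHR}$, respectively.) Both normalized functionals are invariant under scaling of all lengths by a positive constant. A saddle point is a critical point that is neither a local minimum nor a local maximum. *)

(* Defs.v *)
From HB Require Import structures.
From mathcomp Require Import all_boot all_order all_algebra.
From mathcomp Require Import all_classical all_reals all_analysis.

Set Implicit Arguments.
Unset Strict Implicit.
Unset Printing Implicit Defensive.

Import Order.TTheory GRing.Theory Num.Theory.
Import numFieldNormedType.Exports.

Local Open Scope classical_set_scope.
Local Open Scope ring_scope.

(* The vertices 1, 2, 3, 4 are the elements 0, 1, 2, 3 of 'I_4, and the edges
   are indexed by 'I_6 in the order 12, 13, 14, 23, 24, 34, so that the edge
   opposite to e is rev_ord e. *)
Definition edge_ends (e : 'I_6) : 'I_4 * 'I_4 :=
  nth (0, 0)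
    [:: (0, 1); (0, 2); (0, 3); (1, 2); (1, 3); (2, 3)] e.

Section EuclideanGeometry.
Variable R : realType.

Definition dot (n : nat) (u v : 'rV[R]_n) : R := \sum_i u 0 i * v 0 i.

Definition enorm (n : nat) (u : 'rV[R]_n) : R := Num.sqrt (dot u u).

Definition vec_angle (n : nat) (u v : 'rV[R]_n) : R :=
  acos (dot u v / (enorm u * enorm v)).

(* The component of u orthogonal to w. *)
Definition orth (n : nat) (w u : 'rV[R]_n) : 'rV[R]_n :=
  u - (dot u w / dot w w) *: w.

(* A tetrahedron in Euclidean 3-space is given by the matrix whose rows are its
   four vertices. *)
Implicit Types (p : 'M[R]_(4, 3)) (l : 'rV[R]_6).

Definition edge_length p (e : 'I_6) : R :=
  enorm (row (edge_ends e).2 p - row (edge_ends e).1 p).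

Definition edge_frame p : 'M[R]_3 :=
  \matrix_(i < 3) (row (lift ord0 i) p - row ord0 p).

Definition nondegenerate p : Prop := row_free (edge_frame p).

Definition tetra_volume p : R := `|\det (edge_frame p)| / 6.

(* The dihedral angle at the edge ij, where k and m are the other two vertices:
   the angle between the half-planes bounded by the line ij that contain k and
   m, measured orthogonally to ij. *)
Definition tetra_dihedral p (e : 'I_6) : R :=
  let i := (edge_ends e).1 in
  let w := row (edge_ends e).2 p - row i p in
  vec_angle (orth w (row (edge_ends (rev_ord e)).1 p - row i p))
            (orth w (row (edge_ends (rev_ord e)).2 p - row i p)).

Definition generates p l : Prop :=
  nondegenerate p /\ forall e, edge_length p e = l 0 e.

Definition met : set 'rV[R]_6 :=
  [set l : 'rV[R]_6 | (forall e, 0 < l 0 e) /\ exists p, generates p l].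

(* The generating tetrahedron is only determined up to congruence; one is
   chosen, and volume and dihedral angles do not depend on the choice.  The
   default value 0 is used only outside met. *)
Definition generating_tetra l : 'M[R]_(4, 3) :=
  xget 0 [set p | generates p l].

Definition dihedral l (e : 'I_6) : R := tetra_dihedral (generating_tetra l) e.

Definition edge_curv l (e : 'I_6) : R := (2 * pi - 2 * dihedral l e) * l 0 e.

Definition EHR l : R := \sum_e edge_curv l e.

Definition total_length l : R := \sum_e l 0 e.

Definition total_volume l : R := 2 * tetra_volume (generating_tetra l).

Definition LEHR l : R := EHR l / total_length l.

Definition VEHR l : R := EHR l / (total_volume l `^ 3^-1).

Definition equal_length (k : R) : 'rV[R]_6 := const_mx k.

End EuclideanGeometry.

Section Calculus.
Variable R : realType.
Variable n : nat.
Implicit Types (f : 'rV[R]_n.+1 -> R) (x : 'rV[R]_n.+1)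
               (D : set 'rV[R]_n.+1).

Definition basis_vec (i : 'I_n.+1) : 'rV[R]_n.+1 := delta_mx 0 i.

Definition partial (i : 'I_n.+1) f x : R := 'D_(basis_vec i) f x.

(* In the library a derivative that does not exist has an unspecified value, so
   existence is tracked separately. *)
Definition has_partials f x : Prop := forall i, derivable f x (basis_vec i).

Definition has_second_partials f x : Prop :=
  (\forall y \near x, has_partials f y) /\
  forall i, has_partials (partial i f) x.

Definition hessian f x : 'M[R]_n.+1 :=
  \matrix_(i, j) partial j (partial i f) x.

Definition critical_point f x : Prop :=
  differentiable f x /\ forall v, 'd f x v = 0.

Definition local_min_on D f x : Prop :=
  D x /\ \forall y \near x, D y -> f x <= f y.

Definition local_max_on D f x : Prop :=
  D x /\ \forall y \near x, D y -> f y <= f x.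

Definition saddle_point_on D f x : Prop :=
  [/\ D x, critical_point f x,
      ~ local_min_on D f x & ~ local_max_on D f x].

End Calculus.

Section Einstein.
Variable R : realType.
Implicit Types l : 'rV[R]_6.

Definition L_Einstein l : Prop :=
  met l /\ exists lambda : R, forall e, edge_curv l e = lambda * l 0 e.

Definition V_Einstein l : Prop :=
  [/\ met l, has_partials (@total_volume R) l &
      exists lambda : R, forall e,
        edge_curv l e = lambda * (l 0 e * partial e (@total_volume R) l)].

End Einstein.

Section Eigenspaces.
Variable R : realType.

(* The subspaces V_lambda1, V_lambda2 and V_0, each as the row space of the
   matrix whose rows are its spanning vectors. *)
Definition span_rows (m : nat) (s : seq (seq R)) : 'M[R]_(m, 6) :=
  \matrix_(i < m, j < 6) nth 0 (nth [::] s i) j.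

Definition V1 : 'M[R]_(3, 6) := span_rows 3
  [:: [:: 1; 0; 0;   0;   0; - 1];
      [:: 0; 1; 0;   0; - 1;  0];
      [:: 0; 0; 1; - 1;   0;  0]].

Definition V2 : 'M[R]_(2, 6) := span_rows 2
  [:: [:: 0;       1;     - 1;     - 1;       1; 0];
      [:: 1; - 2^-1; - 2^-1; - 2^-1; - 2^-1; 1]].

Definition V0 : 'M[R]_(1, 6) := span_rows 1 [:: [:: 1; 1; 1; 1; 1; 1]].

Definition lambda1_LEHR (k : R) : R := 2 * Num.sqrt 2 / 9 * k ^- 2.

Definition lambda1_VEHR (k : R) : R :=
  2 `^ (7 / 6) * 3 `^ (- (2 / 3)) * k ^- 2
    * (2 `^ (3 / 2) + 9 * pi - 9 * acos (1 / 3)).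

Definition lambda2_LEHR (k : R) : R := - (2 * Num.sqrt 2 / 3) * k ^- 2.

Definition lambda2_VEHR (k : R) : R :=
  2 `^ (7 / 6) * 3 `^ (1 / 3) * k ^- 2
    * (7 * pi - 2 `^ (3 / 2) - 7 * acos (1 / 3)).

End Eigenspaces.

(* Main.v *)
Require Import Defs.
From HB Require Import structures.
From mathcomp Require Import all_boot all_order all_algebra.
From mathcomp Require Import all_classical all_reals all_analysis.
From mathcomp Require Import ring lra.

(* Write s_e for the squared edge lengths and D for the squared determinant of
   an edge frame.  If n_i is the outer normal of the face opposite to the
   vertex i, with norm twice the area of that face, then |n_i|^2 and
   N_ij = - n_i . n_j are polynomials in s, and
     |n_i|^2 = sum_j N_ij  (the faces close up),
     |n_i|^2 |n_j|^2 - N_ij^2 = D s_e, where e is the edge shared by the faces,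
     dD / ds_e = N_e', where e' is the edge opposite to e.
   The dihedral angle at e is acos (N_ij / (|n_i| |n_j|)), so the second
   identity gives its differential, and the differential of the first one gives
   the Schlaefli formula sum_e l_e dbeta_e = 0.  Hence the gradient of EHR is
   2 pi - 2 beta, and one differentiation of beta and D at the regular
   tetrahedron gives both Hessians, which have the form a I + b J + c (all
   ones), J being the exchange of opposite edges.

   A critical point of LEHR, like an L-Einstein metric, has all dihedral angles
   equal.  The first identity then reads |n_i| = cos b * sum_(j <> i) |n_j|, so
   all faces have the same area, and the second one makes all lengths equal.
   The saddle property and, up to rescaling, the local minimality follow from
   the second order Taylor expansion at the regular tetrahedron. *)

Set Implicit Arguments.
Unset Strict Implicit.
Unset Printing Implicit Defensive.

Import Order.TTheory GRing.Theory Num.Theory.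
Import numFieldNormedType.Exports.

Local Open Scope classical_set_scope.
Local Open Scope ring_scope.

(** * Tetrahedra in terms of squared edge lengths *)

Section Polynomials.
Variable R : realType.
Implicit Types (s : nat -> R).

(* Four times the squared area of a triangle with squared side lengths a, b, c. *)
Definition heron (a b c : R) : R := a * b - ((a + b - c) / 2) ^+ 2.

(* With w = |j - i|^2, a = |k - i|^2, b = |k - j|^2, c = |m - i|^2, d = |m - j|^2
   and o = |m - k|^2, this is the dot product of the components of k - i and
   m - i orthogonal to j - i, multiplied by w. *)
Definition cosnum (w a b c d o : R) : R :=
  w * ((a + c - o) / 2) - ((w + a - b) / 2) * ((w + c - d) / 2).

(* |n_i|^2; the face i is the one opposite to the vertex i. *)
Definition area_sq s (i : nat) : R :=
  match i with
  | 0 => heron (s 3) (s 4) (s 5)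
  | 1 => heron (s 1) (s 2) (s 5)
  | 2 => heron (s 0) (s 2) (s 4)
  | _ => heron (s 0) (s 1) (s 3)
  end%N.

(* N_ij, indexed by the edge e shared by the faces i and j. *)
Definition face_cos s (e : nat) : R :=
  match e with
  | 0 => cosnum (s 0) (s 1) (s 3) (s 2) (s 4) (s 5)
  | 1 => cosnum (s 1) (s 0) (s 3) (s 2) (s 5) (s 4)
  | 2 => cosnum (s 2) (s 0) (s 4) (s 1) (s 5) (s 3)
  | 3 => cosnum (s 3) (s 0) (s 1) (s 4) (s 5) (s 2)
  | 4 => cosnum (s 4) (s 0) (s 2) (s 3) (s 5) (s 1)
  | _ => cosnum (s 5) (s 1) (s 2) (s 3) (s 4) (s 0)
  end%N.

Definition edge_faces (e : nat) : nat * nat :=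
  match e with
  | 0 => (2, 3) | 1 => (1, 3) | 2 => (1, 2)
  | 3 => (0, 3) | 4 => (0, 2) | _ => (0, 1)
  end%N.

(** Determinant of the Gram matrix of the edge vectors from the vertex 0; [g] recovers their inner
    products by polarization. *)
Definition gram_det s : R :=
  let g (a b c : R) := (a + b - c) / 2 in
  let g12 := g (s 0) (s 1) (s 3) in
  let g13 := g (s 0) (s 2) (s 4) in
  let g23 := g (s 1) (s 2) (s 5) in
  s 0 * s 1 * s 2 + 2 * g12 * g13 * g23
    - s 0 * g23 ^+ 2 - s 1 * g13 ^+ 2 - s 2 * g12 ^+ 2.

(** With an end of [e] as base vertex, the products of the normals are the entries of the adjugate
    of the Gram matrix. Jacobi's identity equates a 2 x 2 minor of the adjugate with the determinant
    times the complementary entry, here the squared length of [e]. *)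
Lemma jacobi_identity s (e : nat) : (e < 6)%N ->
  area_sq s (edge_faces e).1 * area_sq s (edge_faces e).2 - face_cos s e ^+ 2
  = gram_det s * s e.
Proof.
by case: e => [|[|[|[|[|[|//]]]]]] _;
  rewrite /= /gram_det /cosnum /heron; field.
Qed.

Definition face_edges (i : nat) : seq nat :=
  nth [::] [:: [:: 3; 4; 5]; [:: 1; 2; 5]; [:: 0; 2; 4]; [:: 0; 1; 3]]%N i.

(** The outer normals add up to 0; pair this relation with n_i. Each edge of the face [i] is shared
    with exactly one other face. *)
Lemma area_sq_projection s (i : nat) : (i < 4)%N ->
  area_sq s i = \sum_(e <- face_edges i) face_cos s e.
Proof.
by case: i => [|[|[|[|//]]]] _;
  rewrite /= !big_cons big_nil /= /cosnum /heron; field.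
Qed.

End Polynomials.

(** * Lengths, areas and dihedral angles of a Euclidean tetrahedron, and the set of metrics *)

Section Geometry.
Variable R : realType.

Section Vectors.
Variable n : nat.
Implicit Types u v w a b c : 'rV[R]_n.

Lemma dotC u v : dot u v = dot v u.
Proof. by apply: eq_bigr => i _; rewrite mulrC. Qed.

Lemma dotDl u v w : dot (u + v) w = dot u w + dot v w.
Proof.
by rewrite /dot -big_split; apply: eq_bigr => i _; rewrite !mxE mulrDl.
Qed.

Lemma dotZl k u v : dot (k *: u) v = k * dot u v.
Proof.
by rewrite /dot big_distrr; apply: eq_bigr => i _; rewrite !mxE /= mulrA.
Qed.

Lemma dotNl u v : dot (- u) v = - dot u v.
Proof. by rewrite -scaleN1r dotZl mulN1r. Qed.

Lemma dot_ge0 u : 0 <= dot u u.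
Proof. by apply: sumr_ge0 => i _; rewrite -expr2 sqr_ge0. Qed.

Lemma dot_subrr u v : dot (u - v) (u - v) = dot (v - u) (v - u).
Proof. by rewrite -opprB dotNl dotC dotNl opprK. Qed.

Lemma dot_polar a b c : dot (b - a) (c - a) =
  (dot (b - a) (b - a) + dot (c - a) (c - a) - dot (c - b) (c - b)) / 2.
Proof.
have -> : c - b = (c - a) - (b - a) by rewrite opprB addrA subrK.
move: (b - a) (c - a) => u v.
rewrite (dotDl v) dotNl (dotC v) (dotC u (v - u)) !dotDl !dotNl (dotC v u).
by field.
Qed.

Lemma dot_orth w u v : dot w w != 0 ->
  dot (orth w u) (orth w v) = dot u v - dot u w * dot v w / dot w w.
Proof.
move=> w0; rewrite /orth dotDl dotNl dotZl.
rewrite !(dotC _ (v - _)) !dotDl !dotNl !dotZl (dotC v u) (dotC w u).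
by field.
Qed.

(** Numerator and denominator are both multiplied by |w|^2, which leaves polynomials in the inner
    products. *)
Lemma vec_angle_orth w u v : dot w w != 0 ->
  vec_angle (orth w u) (orth w v) =
  acos ((dot w w * dot u v - dot w u * dot w v) /
    (Num.sqrt (dot w w * dot u u - dot w u ^+ 2) *
     Num.sqrt (dot w w * dot v v - dot w v ^+ 2))).
Proof.
move=> w0; rewrite /vec_angle /enorm !dot_orth// !(dotC _ w).
have wp : 0 < dot w w by rewrite lt_neqAle eq_sym w0 dot_ge0.
set W := dot w w in w0 wp *; set U := dot u u; set V := dot v v.
set A := dot w u; set B := dot w v.
have e x (a : R) : W * x - a ^+ 2 = W * (x - a * a / W) by field.
rewrite !e !sqrtrM ?ltW//.
have -> : W * dot u v - A * B = W * (dot u v - A * B / W) by field.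
rewrite mulrACA -[Num.sqrt W * _]expr2 sqr_sqrtr ?ltW//.
by rewrite -mulf_div divff// mul1r.
Qed.

Lemma vec_angle_edge (i j k m : 'rV[R]_n) :
  let d x y := dot (y - x) (y - x) in d i j != 0 ->
  vec_angle (orth (j - i) (k - i)) (orth (j - i) (m - i)) =
  acos (cosnum (d i j) (d i k) (d j k) (d i m) (d j m) (d k m) /
   (Num.sqrt (heron (d i j) (d i k) (d j k)) *
    Num.sqrt (heron (d i j) (d i m) (d j m)))).
Proof.
move=> d ij0; rewrite vec_angle_orth //.
by rewrite (dot_polar i j k) (dot_polar i j m) (dot_polar i k m).
Qed.

End Vectors.

Lemma det_mx33 (A : 'M[R]_3) :
  let a i j := A (inord i) (inord j) in
  \det A = a 0%N 0%N * (a 1%N 1%N * a 2%N 2%N - a 1%N 2%N * a 2%N 1%N)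
  - a 0%N 1%N * (a 1%N 0%N * a 2%N 2%N - a 1%N 2%N * a 2%N 0%N)
  + a 0%N 2%N * (a 1%N 0%N * a 2%N 1%N - a 1%N 1%N * a 2%N 0%N).
Proof.
move=> a; have aE i j : A i j = a i j by rewrite /a !inord_val.
rewrite (expand_det_row _ ord0) !big_ord_recl big_ord0 /cofactor.
rewrite !(expand_det_row _ ord0) !big_ord_recl !big_ord0 /cofactor ?det_mx11 ?det_mx00.
by rewrite !mxE !aE /= /bump /=; ring.
Qed.

(** Counterpart of [edge_ends] on natural numbers, so that case analysis on the edge computes. *)
Definition edge_vertices (e : nat) : nat * nat :=
  match e with
  | 0 => (0, 1) | 1 => (0, 2) | 2 => (0, 3)
  | 3 => (1, 2) | 4 => (1, 3) | _ => (2, 3)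
  end%N.

Lemma edge_endsE (e : 'I_6) :
  edge_ends e = (inord (edge_vertices e).1, inord (edge_vertices e).2).
Proof.
case: e => [[|[|[|[|[|[|//]]]]]] e6]; rewrite /edge_ends /=;
by congr (_, _); apply: val_inj; rewrite /= inordK.
Qed.

Implicit Types (p : 'M[R]_(4, 3)) (l : 'rV[R]_6).

Definition vertex p (i : nat) : 'rV[R]_3 := row (inord i) p.

Definition sqdist p (i j : nat) : R :=
  dot (vertex p j - vertex p i) (vertex p j - vertex p i).

Definition edge_sqdist p (e : nat) : R :=
  sqdist p (edge_vertices e).1 (edge_vertices e).2.

Lemma sqr_edge_length p e : edge_length p e ^+ 2 = edge_sqdist p e.
Proof. by rewrite /edge_length edge_endsE sqr_sqrtr ?dot_ge0. Qed.

(** The square is the determinant of [F *m F^T], the Gram matrix of the edge vectors at the vertex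
    0. *)
Lemma sqr_det_edge_frame p :
  (\det (edge_frame p)) ^+ 2 = gram_det (edge_sqdist p).
Proof.
set F := edge_frame p.
rewrite expr2 -{2}(det_tr F) -det_mulmx det_mx33.
have GE i j : (i < 3)%N -> (j < 3)%N -> (F *m F^T) (inord i) (inord j) =
   dot (vertex p i.+1 - vertex p 0) (vertex p j.+1 - vertex p 0).
  move=> i3 j3; rewrite mxE /vertex.
  have vE k : (k < 3)%N -> inord k.+1 = lift ord0 (inord k : 'I_3).
    by move=> k3; apply: val_inj; rewrite /= !inordK.
  have -> : inord 0 = ord0 :> 'I_4 by apply: val_inj; rewrite /= inordK.
  by rewrite !vE //; apply: eq_bigr => k _; rewrite !mxE.
have PE i j : dot (vertex p i.+1 - vertex p 0) (vertex p j.+1 - vertex p 0) =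
    (sqdist p 0 i.+1 + sqdist p 0 j.+1 - sqdist p i.+1 j.+1) / 2.
  exact: dot_polar.
have C i j : sqdist p i j = sqdist p j i by exact: dot_subrr.
have Z i : sqdist p i i = 0.
  by rewrite /sqdist subrr /dot big1 // => k _; rewrite mxE mul0r.
rewrite /= !GE // !PE !Z (C 2 1)%N (C 3 1)%N (C 3 2)%N.
by rewrite /gram_det /edge_sqdist /=; field.
Qed.

Lemma heron_swap (a b c : R) : heron a b c = heron b a c.
Proof. by rewrite /heron; field. Qed.

Lemma heron_rot (a b c : R) : heron a b c = heron b c a.
Proof. by rewrite /heron; field. Qed.

Definition cos_dihedral (s : nat -> R) (e : nat) : R :=
  face_cos s e / (Num.sqrt (area_sq s (edge_faces e).1) *
                  Num.sqrt (area_sq s (edge_faces e).2)).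

Lemma tetra_dihedralE p (e : 'I_6) : edge_sqdist p e != 0 ->
  tetra_dihedral p e = acos (cos_dihedral (edge_sqdist p) e).
Proof.
rewrite /tetra_dihedral !edge_endsE /= => e0.
rewrite -/(vertex p (edge_vertices e).1) -/(vertex p (edge_vertices e).2).
rewrite -/(vertex p (edge_vertices (6 - e.+1)).1).
rewrite -/(vertex p (edge_vertices (6 - e.+1)).2).
rewrite vec_angle_edge //.
have C i j : dot (vertex p j - vertex p i) (vertex p j - vertex p i) =
   sqdist p (minn i j) (maxn i j).
  by rewrite /sqdist; case: (leqP i j) => // _; exact: dot_subrr.
rewrite !C; congr acos; have H n a1 a2 b1 b2 : a1 = b1 -> a2 = b2 ->
    n / (Num.sqrt a1 * Num.sqrt a2) = n / (Num.sqrt b1 * Num.sqrt b2) :> R.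
  by move=> -> ->.
(* The first area coming from [vec_angle_edge] is that of the face opposite to the second remaining
   vertex, hence the exchange of factors. *)
rewrite /cos_dihedral [X in _ = _ / X]mulrC.
move: e e0 => [[|[|[|[|[|[|//]]]]]] e6] _;
  rewrite /edge_sqdist /minn /maxn /=; apply: H;
  by [|rewrite heron_swap|rewrite heron_rot|rewrite heron_swap heron_rot].
Qed.

(** Indices from 6 on fall back on the edge 0; the polynomials only read indices below 6. *)
Definition sqlen l (n : nat) : R := l 0 (inord n) ^+ 2.

(** Sylvester's criterion: the leading principal minors of the Gram matrix at the vertex 0 are the
    squared length of the edge 0, [area_sq _ 3] and [gram_det]. *)
Definition tetrahedral l : Prop :=
  [/\ forall e, 0 < l 0 e, 0 < area_sq (sqlen l) 3 & 0 < gram_det (sqlen l)].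

Lemma eq_gram_det (s t : nat -> R) :
  (forall n, (n < 6)%N -> s n = t n) -> gram_det s = gram_det t.
Proof. by move=> st; rewrite /gram_det !st. Qed.

Lemma eq_area_sq (s t : nat -> R) i :
  (forall n, (n < 6)%N -> s n = t n) -> area_sq s i = area_sq t i.
Proof. by move=> st; case: i => [|[|[|i]]]; rewrite /= !st. Qed.

Lemma eq_face_cos (s t : nat -> R) i :
  (forall n, (n < 6)%N -> s n = t n) -> face_cos s i = face_cos t i.
Proof. by move=> st; case: i => [|[|[|[|[|i]]]]]; rewrite /= !st. Qed.

Lemma eq_cos_dihedral (s t : nat -> R) i :
  (forall n, (n < 6)%N -> s n = t n) -> cos_dihedral s i = cos_dihedral t i.
Proof.
by move=> st; rewrite /cos_dihedral (eq_face_cos _ st) !(eq_area_sq _ st).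
Qed.

Lemma generates_sqlen p l : generates p l ->
  forall n, (n < 6)%N -> edge_sqdist p n = sqlen l n.
Proof.
by move=> [_ pl] n n6; rewrite /sqlen -pl sqr_edge_length inordK.
Qed.

Lemma det_edge_frame_neq0 p : Defs.nondegenerate p -> \det (edge_frame p) != 0.
Proof. by rewrite /Defs.nondegenerate row_free_unit unitmxE unitfE. Qed.

Lemma met_tetrahedral l : met l -> tetrahedral l.
Proof.
move=> [lgt0 [p pl]]; have pls := generates_sqlen pl.
have D0 : 0 < gram_det (sqlen l).
  rewrite -(eq_gram_det pls) -sqr_det_edge_frame exprn_even_gt0 //=.
  exact/det_edge_frame_neq0/pl.1.
split=> //; have s0 n : 0 < sqlen l n by rewrite exprn_gt0.
(* By the Jacobi identity at the edge 0 this product is a square plus a positive term. So the area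
   is nonzero, and it remains to see that it is nonnegative: it is |u|^2 times the squared norm of
   the part of [v] orthogonal to [u]. *)
have : area_sq (sqlen l) 2 * area_sq (sqlen l) 3 != 0.
  rewrite gt_eqF // -(subrK (face_cos (sqlen l) 0 ^+ 2) (_ * _)).
  rewrite (@jacobi_identity _ _ 0) //.
  by rewrite ltr_wpDr ?sqr_ge0 // mulr_gt0.
rewrite mulf_eq0 negb_or => /andP[_ A0]; rewrite lt_neqAle eq_sym A0.
rewrite -(eq_area_sq _ pls) /= /heron /edge_sqdist /=.
set u := vertex p 1 - vertex p 0; set v := vertex p 2 - vertex p 0.
have u0 : 0 < dot u u by have := s0 0%N; rewrite -pls.
have -> : (sqdist p 0 1 + sqdist p 0 2 - sqdist p 1 2) / 2 = dot u v.
  by rewrite dot_polar.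
have -> : sqdist p 0 1 * sqdist p 0 2 - dot u v ^+ 2
   = dot u u * dot (orth u v) (orth u v).
  rewrite dot_orth ?gt_eqF // (dotC v u) /sqdist -/u -/v.
  by field; rewrite gt_eqF.
by rewrite mulr_ge0 ?dot_ge0.
Qed.

(* The edge frame is the Cholesky factor of the Gram matrix that the lengths
   prescribe. *)
Lemma cholesky_tetrahedron l : tetrahedral l ->
  exists p, forall n, (n < 6)%N -> edge_sqdist p n = sqlen l n.
Proof.
move=> [l0 A0 D0]; pose s := sqlen l.
pose A := area_sq s 3; pose a := l 0 (inord 0).
pose g12 := (s 0%N + s 1%N - s 3%N) / 2; pose g13 := (s 0%N + s 2%N - s 4%N) / 2.
pose g23 := (s 1%N + s 2%N - s 5%N) / 2.
pose b := g12 / a; pose c := Num.sqrt (A / s 0%N).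
pose d := g13 / a; pose e := (g23 - b * d) / c.
pose f := Num.sqrt (gram_det s / A).
have s00 : 0 < s 0%N by rewrite exprn_gt0.
have a0 : a != 0 by rewrite gt_eqF // l0.
have c0 : c != 0 by rewrite gt_eqF // sqrtr_gt0 divr_gt0 //.
have aa : a * a = s 0%N by [].
have cc : c * c = A / s 0%N by rewrite -expr2 sqr_sqrtr // divr_ge0 // ltW.
have ff : f * f = gram_det s / A by rewrite -expr2 sqr_sqrtr // divr_ge0 // ltW.
have AE : A = s 0%N * s 1%N - g12 ^+ 2 by [].
have AN0 : A != 0 by rewrite gt_eqF.
have s0N0 : s 0%N != 0 by rewrite gt_eqF.
have h3 : a * b = g12 by rewrite mulrC divfK.
have h4 : a * d = g13 by rewrite mulrC divfK.
have h5 : b * d + c * e = g23 by rewrite [c * e]mulrC divfK // addrC subrK.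
have bd : b * d = g12 * g13 / s 0%N by rewrite -aa /b /d; field.
have h1 : b * b + c * c = s 1%N.
  have -> : b * b = g12 ^+ 2 / s 0%N by rewrite -aa /b; field.
  by rewrite cc AE; field.
have h2 : d * d + e * e + f * f = s 2%N.
  have -> : d * d = g13 ^+ 2 / s 0%N by rewrite -aa /d; field.
  have -> : e * e = (g23 - b * d) ^+ 2 / (c * c) by rewrite /e; field.
  rewrite ff bd cc.
  have -> : gram_det s = s 0%N * s 1%N * s 2%N + 2 * g12 * g13 * g23
    - s 0%N * g23 ^+ 2 - s 1%N * g13 ^+ 2 - s 2%N * g12 ^+ 2 by [].
  move: AN0; rewrite AE => AN0; field.
  by rewrite s0N0 AN0.
(* The vertex 0 is the origin; the default value of [nth] pads the triangular rows with zeros. *)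
pose rows := [:: [::]; [:: a]; [:: b; c]; [:: d; e; f]].
exists (\matrix_(i < 4, j < 3) nth 0 (nth [::] rows i) j).
set p := (X in edge_sqdist X).
have vE i j : (i < 4)%N -> vertex p i 0 j = nth 0 (nth [::] rows i) j.
  by move=> i4; rewrite !mxE inordK.
have sE i j : (i < 4)%N -> (j < 4)%N -> sqdist p i j =
    (nth 0 (nth [::] rows j) 0 - nth 0 (nth [::] rows i) 0) ^+ 2 +
    (nth 0 (nth [::] rows j) 1 - nth 0 (nth [::] rows i) 1) ^+ 2 +
    (nth 0 (nth [::] rows j) 2 - nth 0 (nth [::] rows i) 2) ^+ 2.
  move=> i4 j4; rewrite /sqdist /dot !big_ord_recl big_ord0 addr0.
  by rewrite ![(vertex p j - _) _ _]mxE ![(- vertex p i) _ _]mxE !vE // !addrA.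
rewrite -/s; move: aa h1 h2 h3 h4 h5; rewrite /g12 /g13 /g23 => aa h1 h2 h3 h4 h5.
by case=> [|[|[|[|[|[|//]]]]]] _; rewrite /edge_sqdist sE //=; lra.
Qed.

Lemma tetrahedral_met l : tetrahedral l -> met l.
Proof.
move=> lT; have [l0 _ D0] := lT; have [p pl] := cholesky_tetrahedron lT.
split=> //; exists p; split=> [|e].
  rewrite /Defs.nondegenerate row_free_unit unitmxE unitfE.
  by rewrite -[_ == 0](@expf_eq0 _ _ 2) sqr_det_edge_frame (eq_gram_det pl) gt_eqF.
apply: (@pexpIrn _ 2) => //; rewrite ?nnegrE ?sqrtr_ge0 ?ltW //.
by rewrite sqr_edge_length pl // /sqlen inord_val.
Qed.

Lemma metP l : met l <-> tetrahedral l.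
Proof. by split; [exact: met_tetrahedral|exact: tetrahedral_met]. Qed.

Lemma generating_tetraP l : met l -> generates (generating_tetra l) l.
Proof.
by move=> [_ [p pl]]; rewrite /generating_tetra; case: xgetP => [q _ //|/(_ p)].
Qed.

Lemma dihedralE l (e : 'I_6) : met l ->
  dihedral l e = acos (cos_dihedral (sqlen l) e).
Proof.
move=> lM; have pl := generates_sqlen (generating_tetraP lM).
rewrite /dihedral tetra_dihedralE ?(eq_cos_dihedral _ pl) //.
by rewrite pl // gt_eqF // exprn_gt0 // lM.1.
Qed.

Lemma total_volumeE l : met l ->
  total_volume l = Num.sqrt (gram_det (sqlen l)) / 3.
Proof.
move=> lM; have pl := generates_sqlen (generating_tetraP lM).
rewrite /total_volume /tetra_volume -(eq_gram_det pl) -sqr_det_edge_frame.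
by rewrite sqrtr_sqr; field.
Qed.

(** Positivity spreads from the face 3 to the others through the Jacobi identity at the edges 0, 1
    and 3, which it shares with them. *)
Lemma area_sq_gt0 l i : met l -> 0 < area_sq (sqlen l) i.
Proof.
move=> /metP[l0 A0 D0]; have s0 n : 0 < sqlen l n by rewrite exprn_gt0.
have key e : (e < 6)%N -> 0 < area_sq (sqlen l) (edge_faces e).1 *
                              area_sq (sqlen l) (edge_faces e).2.
  move=> e6; rewrite -(subrK (face_cos (sqlen l) e ^+ 2) (_ * _)).
  by rewrite jacobi_identity // ltr_wpDr ?sqr_ge0 // mulr_gt0.
have := key 0%N isT; have := key 1%N isT; have := key 3%N isT.
rewrite ![edge_faces _]/= !pmulr_lgt0 //.
by case: i => [|[|[|i]]].
Qed.

Lemma sqr_face_cos_lt l e : met l -> (e < 6)%N ->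
  face_cos (sqlen l) e ^+ 2 <
  area_sq (sqlen l) (edge_faces e).1 * area_sq (sqlen l) (edge_faces e).2.
Proof.
move=> /metP[l0 A0 D0] e6.
by rewrite -subr_gt0 jacobi_identity // mulr_gt0 // exprn_gt0.
Qed.

End Geometry.

(** * Differentials of scalar functions and Taylor expansion *)

Section ScalarDifferentials.
Variables (R : realType) (V : normedModType R).
Implicit Types (f g df dg N P Q dN dP dQ : V -> R) (x : V).

Lemma is_diff_ext f df dg x : is_diff x f df -> df =1 dg -> is_diff x f dg.
Proof. by move=> fx /funext <-. Qed.

Lemma is_diff_addf f g df dg x : is_diff x f df -> is_diff x g dg ->
  is_diff x (fun y => f y + g y) (fun v => df v + dg v).
Proof. by move=> fx gx; exact: is_diffD. Qed.

Lemma is_diff_mulf f g df dg x : is_diff x f df -> is_diff x g dg ->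
  is_diff x (fun y => f y * g y) (fun v => f x * dg v + g x * df v).
Proof. by move=> fx gx; exact: is_diffM. Qed.

Lemma is_diff_scalef (c : R) f df x : is_diff x f df ->
  is_diff x (fun y => c * f y) (fun v => c * df v).
Proof. by move=> fx; exact: is_diffZ. Qed.

Lemma is_diff_subf f g df dg x : is_diff x f df -> is_diff x g dg ->
  is_diff x (fun y => f y - g y) (fun v => df v - dg v).
Proof. by move=> fx gx; exact: is_diffB. Qed.

Lemma is_diff_sumf (I : Type) (r : seq I) (F dF : I -> V -> R) x :
  (forall i, is_diff x (F i) (dF i)) ->
  is_diff x (fun y => \sum_(i <- r) F i y) (fun v => \sum_(i <- r) dF i v).
Proof.
move=> Fx; elim: r => [|i r IHr].
  have -> : (fun y => \sum_(i <- [::]) F i y) = cst (0 : R).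
    by apply/funext => y; rewrite big_nil.
  have -> : (fun v => \sum_(i <- [::]) dF i v) = 0.
    by apply/funext => y; rewrite big_nil.
  exact: is_diff_cst.
have -> : (fun y => \sum_(j <- i :: r) F j y) =
    (fun y => F i y + \sum_(j <- r) F j y).
  by apply/funext => y; rewrite big_cons.
apply: is_diff_ext (is_diff_addf (Fx i) IHr) _ => v; rewrite big_cons //.
Qed.

Lemma is_diff_comp1 (phi : R -> R) (c : R) f df x :
  is_derive (f x) 1 phi c -> is_diff x f df ->
  is_diff x (fun y => phi (f y)) (fun v => c * df v).
Proof.
move=> [phid phiE] fx.
have phidiff : is_diff (f x) phi (fun h => c * h).
  apply: DiffDef; first exact/derivable1_diffP.
  apply/funext => h; rewrite diff1E; last exact/derivable1_diffP.
  by rewrite derive1E phiE [LHS]mulrC.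
exact: (is_diff_comp fx phidiff).
Qed.

(** Angles and volume are defined through a chosen tetrahedron and agree with their explicit
    formulas only on [met]; this carries differentials over. *)
Lemma near_is_diff f g df x : (\forall y \near x, f y = g y) ->
  is_diff x f df -> is_diff x g df.
Proof.
move=> fg [fd <-]; have [fc fo] := (diff_locallyP _ _).1 fd.
have fgx : f x = g x by exact: nbhs_singleton fg.
have go : g \o shift x = cst (g x) + 'd f x +o_ 0 id.
  apply/eqaddoP => e e0; have /eqaddoP/(_ _ e0) fo' := fo.
  have fg0 : \forall h \near 0, f (h + x) = g (h + x).
    by have := fg; rewrite (near_shift 0) /=; apply: filterS => h; rewrite /= subr0.
  apply: filterS2 fo' fg0 => h le1 fgh.
  suff -> : (g \o shift x - (cst (g x) + 'd f x)) h =
      (f \o shift x - (cst (f x) + 'd f x)) h by [].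
  rewrite -[LHS]/(g (h + x) - (g x + 'd f x h)) -fgh -fgx.
  by rewrite -[RHS]/(f (h + x) - (f x + 'd f x h)).
have gE : 'd g x = 'd f x :> (V -> R) by apply: diff_unique.
apply: DiffDef; last exact: gE.
by apply/diff_locallyP; rewrite gE; split.
Qed.

Lemma is_diff_littleo f df x : is_diff x f df -> forall e, 0 < e ->
  \forall h \near (0 : V), `|f (x + h) - f x - df h| <= e * `|h|.
Proof.
move=> [fd <-] e e0; have [_ /eqaddoP/(_ _ e0)] := (diff_locallyP _ _).1 fd.
by apply: filterS => h; rewrite /= ![(_ - _) h]/= /= opprD addrA (addrC x).
Qed.

Lemma is_diff_invf f df x : f x != 0 -> is_diff x f df ->
  is_diff x (fun y => (f y)^-1) (fun v => - df v / f x ^+ 2).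
Proof.
move=> fx0 fx; apply: DiffDef; first exact: differentiableV.
apply/funext => v; rewrite diffV // (@diff_val _ _ _ _ _ _ _ fx).
by rewrite /GRing.scale /= mulNr [LHS]mulrC mulrN.
Qed.

Lemma is_diff_gt0_near f df x : is_diff x f df -> 0 < f x ->
  \forall y \near x, 0 < f y.
Proof.
move=> fx f0; have /differentiable_continuous fc := @ex_diff _ _ _ _ _ _ _ fx.
exact: cvgr_gt fc _ f0.
Qed.

(** For the cosine c one has 1 - c^2 = (P Q - N^2) / (P Q), so the derivative of [acos] brings in
    the root of P Q - N^2. For a dihedral angle that quantity is D s_e. *)
Lemma is_diff_acos_div N P Q dN dP dQ x :
  0 < P x -> 0 < Q x -> N x ^+ 2 < P x * Q x ->
  is_diff x N dN -> is_diff x P dP -> is_diff x Q dQ ->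
  is_diff x (fun y => acos (N y / (Num.sqrt (P y) * Num.sqrt (Q y))))
    (fun v => (N x * (dP v / (2 * P x) + dQ v / (2 * Q x)) - dN v)
                / Num.sqrt (P x * Q x - N x ^+ 2)).
Proof.
move=> P0 Q0 NPQ dNx dPx dQx.
have dp := is_diff_comp1 (is_derive1_sqrt P0) dPx.
have dq := is_diff_comp1 (is_derive1_sqrt Q0) dQx.
set p := Num.sqrt (P x) in dp; set q := Num.sqrt (Q x) in dq.
have p0 : 0 < p by rewrite sqrtr_gt0.
have q0 : 0 < q by rewrite sqrtr_gt0.
have PE : P x = p ^+ 2 by rewrite sqr_sqrtr // ltW.
have QE : Q x = q ^+ 2 by rewrite sqr_sqrtr // ltW.
have pqN0 : p * q != 0 by rewrite mulf_neq0 // gt_eqF.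
have dc := is_diff_mulf dNx (is_diff_invf pqN0 (is_diff_mulf dp dq)).
set c := N x / (p * q).
have c2 : c ^+ 2 < 1.
  by rewrite expr_div_n ltr_pdivrMr ?exprn_gt0 ?mulr_gt0 // mul1r exprMn -PE -QE.
have c1 : -1 < c < 1.
  by rewrite -ltr_norml -(@expr_lt1 _ 2) // real_normK // num_real.
have dF := is_diff_comp1 (is_derive1_acos c1) dc.
apply: is_diff_ext dF _ => v; rewrite -/c -/p -/q.
have sE : Num.sqrt (1 - c ^+ 2) = Num.sqrt (P x * Q x - N x ^+ 2) / (p * q).
  have -> : 1 - c ^+ 2 = (P x * Q x - N x ^+ 2) * (p * q)^-1 ^+ 2.
    by rewrite /c PE QE; field; rewrite !gt_eqF.
  rewrite sqrtrM ?subr_ge0 1?ltW // sqrtr_sqr ger0_norm //.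
  by rewrite invr_ge0 mulr_ge0 // ltW.
have w0 : 0 < Num.sqrt (P x * Q x - N x ^+ 2) by rewrite sqrtr_gt0 subr_gt0.
rewrite sE PE QE in w0 *; set w := Num.sqrt _ in w0 *.
by field; rewrite !gt_eqF.
Qed.

End ScalarDifferentials.

Section Taylor.
Variables (R : realType) (n : nat).
Implicit Types (f : 'rV[R]_n.+1 -> R) (x v : 'rV[R]_n.+1).

Lemma coord_norm_le v i : `|v 0 i| <= `|v|.
Proof.
rewrite [leRHS]mx_normrE; pose F (p : 'I_1 * 'I_n.+1) := `|v p.1 p.2|.
exact: (le_bigmax _ F (0, i)).
Qed.

(** Mean value theorem for [phi], which is f minus its linear and quadratic terms along the segment
    from [x] to [x + v]. Its derivative is small because each [g i] is differentiable at [x]. *)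
Lemma taylor2_near f (g : 'I_n.+1 -> 'rV[R]_n.+1 -> R) (H : 'M[R]_n.+1) x :
  (\forall y \near x, is_diff y f (fun v => \sum_i g i y * v 0 i)) ->
  (forall i, is_diff x (g i) (fun v => \sum_j H i j * v 0 j)) ->
  forall e : R, 0 < e -> \forall v \near (0 : 'rV[R]_n.+1),
    `|f (x + v) - f x - \sum_i g i x * v 0 i
      - 2^-1 * \sum_i \sum_j H i j * v 0 i * v 0 j| <= e * `|v| ^+ 2.
Proof.
move=> fd gd e e0.
(* The errors of the [n.+1] components of the gradient will be added. *)
pose e1 := e / n.+1%:R; have e10 : 0 < e1 by rewrite divr_gt0.
have gn : \forall h \near (0 : 'rV[R]_n.+1), forall i,
    `|g i (x + h) - g i x - \sum_j H i j * h 0 j| <= e1 * `|h|.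
  apply: (@filter_forall _ _ (fun i h => `|g i (x + h) - g i x
    - \sum_j H i j * h 0 j| <= e1 * `|h|) _ (nbhs_filter _)) => i.
  exact: is_diff_littleo (gd i) _ e10.
have fd0 : \forall h \near (0 : 'rV[R]_n.+1),
    is_diff (x + h) f (fun v => \sum_i g i (x + h) * v 0 i).
  have := fd; rewrite (near_shift 0) /=; apply: filterS => h.
  by rewrite /= subr0 addrC.
have [r r0 rP] : exists2 r, 0 < r & forall h : 'rV[R]_n.+1, `|h| < r ->
    (forall i, `|g i (x + h) - g i x - \sum_j H i j * h 0 j| <= e1 * `|h|) /\
    is_diff (x + h) f (fun v => \sum_i g i (x + h) * v 0 i).
  have [r /= r0 rP] := (nbhs_ballP _ _).1 (filterI gn fd0).
  exists r => // h hr; apply: (rP h).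
  by rewrite -ball_normE /ball_ /= sub0r normrN.
apply/nbhs_ballP; exists r => // v; rewrite -ball_normE /ball_ /= sub0r normrN.
move=> vr.
pose q := \sum_i \sum_j H i j * v 0 i * v 0 j.
pose l := \sum_i g i x * v 0 i.
pose phi (t : R) := f (x + t *: v) - t * l - t ^+ 2 * (2^-1 * q).
pose dphi (t : R) := \sum_i g i (x + t *: v) * v 0 i - l - t * q.
have tr t : 0 <= t <= 1 -> `|t *: v| < r.
  move=> /andP[t0 t1]; rewrite normrZ ger0_norm //.
  by rewrite (le_lt_trans _ vr) // ler_piMl.
have phid (t : R) : 0 <= t <= 1 -> is_derive t 1 phi (dphi t).
  move=> t01; have [_ fx] := rP _ (tr _ t01).
  have dl : is_diff t (fun s : R => x + s *: v) (fun s : R => s *: v).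
    have := is_diffD (is_diff_cst x t) (is_diff_scalel t v).
    by move/is_diff_eq; apply; apply/funext => s; rewrite /= add0r.
  have fl := is_diff_comp dl fx.
  have d1 : is_derive t 1 (fun s => f (x + s *: v))
      (\sum_i g i (x + t *: v) * v 0 i).
    apply: DeriveDef; first exact/derivable1_diffP/(@ex_diff _ _ _ _ _ _ _ fl).
    rewrite deriveE; last exact: (@ex_diff _ _ _ _ _ _ _ fl).
    rewrite (@diff_val _ _ _ _ _ _ _ fl) /=.
    by apply: eq_bigr => i _; rewrite mxE mul1r.
  have d2 : is_derive t 1 (fun s => s * l) l.
    have := is_deriveM (is_derive_id t (1 : R)) (is_derive_cst l t (1:R)).
    by move/is_derive_eq; apply; rewrite scaler0 add0r /= [LHS]mulr1.
  have d3 : is_derive t 1 (fun s => s ^+ 2 * (2^-1 * q)) (t * q).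
    have := is_deriveM (is_deriveX 2 (is_derive_id t (1 : R)))
      (is_derive_cst (2^-1 * q) t (1:R)).
    move/is_derive_eq; apply; rewrite scaler0 add0r.
    by rewrite /GRing.scale /= expr1; field.
  exact: (is_deriveB (is_deriveB d1 d2) d3).
have [c c01 cE] : exists2 c, c \in `]0, 1[%R & phi 1 - phi 0 = dphi c * (1 - 0).
  apply: MVT => //.
    by move=> t /itvP t01; apply: phid; rewrite !t01.
  apply: derivable_within_continuous => t /itvP t01.
  by have [] : is_derive t 1 phi (dphi t) by apply: phid; rewrite !t01.
have c1 : 0 <= c <= 1 by rewrite !(itvP c01).
have := cE; rewrite subr0 mulr1 /phi scale1r scale0r addr0 !mul0r expr0n mul0r.
rewrite expr1n !mul1r !subr0 => E.
have -> : f (x + v) - f x - l - 2^-1 * q = dphi c.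
  by rewrite -E; ring.
have -> : dphi c = \sum_i (g i (x + c *: v) - g i x
    - \sum_j H i j * (c *: v) 0 j) * v 0 i.
  rewrite /dphi /l /q big_distrr /= -!sumrB; apply: eq_bigr => i _.
  rewrite !mulrBl; congr (_ - _); rewrite big_distrr big_distrl /=.
  by apply: eq_bigr => j _; rewrite mxE; ring.
apply: le_trans (ler_norm_sum _ _ _) _.
have -> : e * `|v| ^+ 2 = \sum_(i < n.+1) e1 * `|v| * `|v|.
  by rewrite sumr_const card_ord -mulr_natl /e1; field.
apply: ler_sum => i _; rewrite normrM ler_pM ?coord_norm_le //.
have [/(_ i) gi _] := rP _ (tr _ c1); apply: le_trans gi _.
rewrite ler_pM2l // normrZ ler_piMl //.
by have /andP[? ?] := c1; rewrite ger0_norm.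
Qed.

End Taylor.

(** * Differentials of the polynomials in the squared lengths *)

Section PolynomialDifferentials.
Variable R : realType.
Implicit Types s t : nat -> R.

Definition dheron (a b c da db dc : R) : R :=
  da * b + a * db - (a + b - c) / 2 * (da + db - dc).

Definition dcosnum (w a b c d o dw da db dc dd dopp : R) : R :=
  dw * ((a + c - o) / 2) + w * ((da + dc - dopp) / 2)
  - (dw + da - db) / 2 * ((w + c - d) / 2)
  - (w + a - b) / 2 * ((dw + dc - dd) / 2).

Definition darea_sq s t (i : nat) : R :=
  match i with
  | 0 => dheron (s 3) (s 4) (s 5) (t 3) (t 4) (t 5)
  | 1 => dheron (s 1) (s 2) (s 5) (t 1) (t 2) (t 5)
  | 2 => dheron (s 0) (s 2) (s 4) (t 0) (t 2) (t 4)
  | _ => dheron (s 0) (s 1) (s 3) (t 0) (t 1) (t 3)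
  end%N.

Definition dface_cos s t (e : nat) : R :=
  match e with
  | 0 => dcosnum (s 0) (s 1) (s 3) (s 2) (s 4) (s 5)
                 (t 0) (t 1) (t 3) (t 2) (t 4) (t 5)
  | 1 => dcosnum (s 1) (s 0) (s 3) (s 2) (s 5) (s 4)
                 (t 1) (t 0) (t 3) (t 2) (t 5) (t 4)
  | 2 => dcosnum (s 2) (s 0) (s 4) (s 1) (s 5) (s 3)
                 (t 2) (t 0) (t 4) (t 1) (t 5) (t 3)
  | 3 => dcosnum (s 3) (s 0) (s 1) (s 4) (s 5) (s 2)
                 (t 3) (t 0) (t 1) (t 4) (t 5) (t 2)
  | 4 => dcosnum (s 4) (s 0) (s 2) (s 3) (s 5) (s 1)
                 (t 4) (t 0) (t 2) (t 3) (t 5) (t 1)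
  | _ => dcosnum (s 5) (s 1) (s 2) (s 3) (s 4) (s 0)
                 (t 5) (t 1) (t 2) (t 3) (t 4) (t 0)
  end%N.

(* dD / ds_e is the polynomial N of the edge opposite to e. *)
Definition dgram_det s t : R := \sum_(e < 6) face_cos s (5 - e) * t e.

Lemma darea_sq_projection s t (i : nat) : (i < 4)%N ->
  darea_sq s t i = \sum_(e <- face_edges i) dface_cos s t e.
Proof.
by case: i => [|[|[|[|//]]]] _;
  rewrite /= !big_cons big_nil /= /dcosnum /dheron; field.
Qed.

Variable V : normedModType R.
Implicit Types (x : V) (f g df dg : V -> R)
  (w a b c d o dw da db dc dd dopp : V -> R).

Lemma is_diff_ext2 f g df dg x : is_diff x f df -> f =1 g -> df =1 dg ->
  is_diff x g dg.
Proof. by move=> fx /funext <- /funext <-. Qed.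

Lemma is_diff_dot_polar a b c da db dc x :
  is_diff x a da -> is_diff x b db -> is_diff x c dc ->
  is_diff x (fun y => (a y + b y - c y) / 2)
            (fun v => (da v + db v - dc v) / 2).
Proof.
move=> ax bx cx.
apply: is_diff_ext2 (is_diff_scalef 2^-1 (is_diff_subf (is_diff_addf ax bx) cx)) _ _.
all: by move=> y; rewrite mulrC.
Qed.

Lemma is_diff_heron a b c da db dc x :
  is_diff x a da -> is_diff x b db -> is_diff x c dc ->
  is_diff x (fun y => heron (a y) (b y) (c y))
    (fun v => dheron (a x) (b x) (c x) (da v) (db v) (dc v)).
Proof.
move=> ax bx cx; have gx := is_diff_dot_polar ax bx cx.
apply: is_diff_ext2 (is_diff_subf (is_diff_mulf ax bx) (is_diff_mulf gx gx)) _ _.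
  by move=> y; rewrite /heron expr2.
by move=> v; rewrite /dheron; field.
Qed.

Lemma is_diff_cosnum w a b c d o dw da db dc dd dopp x :
  is_diff x w dw -> is_diff x a da -> is_diff x b db -> is_diff x c dc ->
  is_diff x d dd -> is_diff x o dopp ->
  is_diff x (fun y => cosnum (w y) (a y) (b y) (c y) (d y) (o y))
    (fun v => dcosnum (w x) (a x) (b x) (c x) (d x) (o x)
                      (dw v) (da v) (db v) (dc v) (dd v) (dopp v)).
Proof.
move=> wx ax bx cx dx ox.
apply: is_diff_ext2 (is_diff_subf (is_diff_mulf wx (is_diff_dot_polar ax cx ox))
  (is_diff_mulf (is_diff_dot_polar wx ax bx) (is_diff_dot_polar wx cx dx))) _ _.
  by move=> y; rewrite /cosnum.
by move=> v; rewrite /dcosnum; field.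
Qed.

Variables (x : V) (s ds : V -> nat -> R).
Hypothesis sx : forall n, is_diff x (s^~ n) (ds^~ n).

Lemma is_diff_area_sq i :
  is_diff x (fun y => area_sq (s y) i) (fun v => darea_sq (s x) (ds v) i).
Proof. by case: i => [|[|[|i]]]; apply: is_diff_heron. Qed.

Lemma is_diff_face_cos e :
  is_diff x (fun y => face_cos (s y) e) (fun v => dface_cos (s x) (ds v) e).
Proof. by case: e => [|[|[|[|[|e]]]]]; apply: is_diff_cosnum. Qed.

Lemma is_diff_gram_det :
  is_diff x (fun y => gram_det (s y)) (fun v => dgram_det (s x) (ds v)).
Proof.
have g12 := is_diff_dot_polar (sx 0) (sx 1) (sx 3).
have g13 := is_diff_dot_polar (sx 0) (sx 2) (sx 4).
have g23 := is_diff_dot_polar (sx 1) (sx 2) (sx 5).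
have P0 := is_diff_mulf (is_diff_mulf (sx 0) (sx 1)) (sx 2).
have P1 := is_diff_scalef 2 (is_diff_mulf (is_diff_mulf g12 g13) g23).
have Q0 := is_diff_mulf (sx 0) (is_diff_mulf g23 g23).
have Q1 := is_diff_mulf (sx 1) (is_diff_mulf g13 g13).
have Q2 := is_diff_mulf (sx 2) (is_diff_mulf g12 g12).
apply: is_diff_ext2 (is_diff_subf (is_diff_subf
  (is_diff_subf (is_diff_addf P0 P1) Q0) Q1) Q2) _ _.
  by move=> y; rewrite /gram_det; ring.
move=> v; rewrite /dgram_det !big_ord_recl big_ord0 /= /bump /= /cosnum.
by field.
Qed.

End PolynomialDifferentials.

Section Dihedral.
Variable R : realType.
Implicit Types l v : 'rV[R]_6.

Lemma is_diff_coord (n : nat) (l : 'rV[R]_n) (i : 'I_n) :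
  is_diff l (fun y : 'rV[R]_n => y 0 i) (fun y : 'rV[R]_n => y 0 i).
Proof.
have flin : linear (fun y : 'rV[R]_n => y 0 i : R) by move=> ? ? ?; rewrite !mxE.
pose fL := GRing.isLinear.Build _ _ _ _ _ flin.
pose f : {linear _ -> _} := HB.pack (fun y : 'rV[R]_n => y 0 i : R) fL.
have fc : continuous f by exact: coord_continuous.
apply: DiffDef; first exact: differentiable_coord.
by rewrite -[X in 'd X _]/(f : _ -> _) (diff_lin _ fc).
Qed.

Definition dsqlen l v (n : nat) : R := 2 * l 0 (inord n) * v 0 (inord n).

Lemma is_diff_sqlen l n :
  is_diff l (fun y => sqlen y n) (fun v => dsqlen l v n).
Proof.
have dx := is_diff_coord l (inord n : 'I_6).
apply: is_diff_ext2 (is_diff_mulf dx dx) _ _ => y; first by rewrite /sqlen expr2.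
by rewrite /dsqlen; ring.
Qed.

End Dihedral.

(** * Variation of dihedral angles and volume *)

Section Curvature.
Variable R : realType.
Implicit Types l v y : 'rV[R]_6.

Lemma met_near l : met l -> \forall y \near l, met y.
Proof.
move=> /metP[l0 A0 D0].
have n0 : \forall y \near l, forall e, 0 < (y : 'rV[R]_6) 0 e.
  apply: (@filter_forall _ _ (fun e (y : 'rV[R]_6) => 0 < y 0 e) _
    (nbhs_filter _)) => e.
  exact: is_diff_gt0_near (is_diff_coord l e) (l0 e).
have n1 := is_diff_gt0_near (is_diff_area_sq (is_diff_sqlen l) 3) A0.
have n2 := is_diff_gt0_near (is_diff_gram_det (is_diff_sqlen l)) D0.
near=> y; apply/metP; split; near: y; assumption.
Unshelve. all: by end_near. Qed.

Lemma sum_edges (F : nat -> R) :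
  \sum_(e < 6) F e = F 0%N + F 1%N + F 2%N + F 3%N + F 4%N + F 5%N.
Proof. by rewrite !big_ord_recr big_ord0 /= add0r. Qed.

(** Logarithmic derivative of |n_i|, hence of the area of the face [i]. *)
Definition darea_log l v (i : nat) : R :=
  darea_sq (sqlen l) (dsqlen l v) i / (2 * area_sq (sqlen l) i).

Definition ddihedral l v (e : nat) : R :=
  (face_cos (sqlen l) e * (darea_log l v (edge_faces e).1 +
                           darea_log l v (edge_faces e).2)
     - dface_cos (sqlen l) (dsqlen l v) e)
  / Num.sqrt (gram_det (sqlen l) * sqlen l e).

Lemma is_diff_dihedral l (e : 'I_6) : met l ->
  is_diff l (fun y => dihedral y e) (fun v => ddihedral l v e).
Proof.
move=> lM; have sd := is_diff_sqlen l.
have dF := is_diff_acos_div (area_sq_gt0 _ lM) (area_sq_gt0 _ lM)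
  (sqr_face_cos_lt lM (ltn_ord e)) (is_diff_face_cos sd e)
  (is_diff_area_sq sd (edge_faces e).1) (is_diff_area_sq sd (edge_faces e).2).
apply: near_is_diff (is_diff_ext dF _).
  by apply: filterS (met_near lM) => y /dihedralE ->.
by move=> v; rewrite jacobi_identity.
Qed.

(* Both N_e and dN_e are summed face by face, through |n_i|^2 = sum_j N_ij. *)
Lemma schlafli l v : met l -> \sum_e l 0 e * ddihedral l v e = 0.
Proof.
move=> lM; have [l0 _ D0] := (metP l).1 lM.
pose X (e : nat) := face_cos (sqlen l) e * (darea_log l v (edge_faces e).1 +
   darea_log l v (edge_faces e).2) - dface_cos (sqlen l) (dsqlen l v) e.
(* The factor l_e cancels the root of s_e, leaving a denominator common to all edges. *)
have E e : l 0 e * ddihedral l v e = X e / Num.sqrt (gram_det (sqlen l)).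
  rewrite /ddihedral -/(X e) sqrtrM ?ltW // /sqlen inord_val sqrtr_sqr.
  rewrite gtr0_norm //; field.
  by rewrite !gt_eqF ?sqrtr_gt0 ?l0.
rewrite (eq_bigr _ (fun e _ => E e)) -big_distrl /= sum_edges.
suff -> : X 0%N + X 1%N + X 2%N + X 3%N + X 4%N + X 5%N = 0 by rewrite mul0r.
(* With h_i for [darea_log l v i], the sum of N_e (h_i + h_j) over the edges is the sum of |n_i|^2
   h_i, half the sum of the d|n_i|^2. Each edge lies on two faces, so this is the sum of the
   dN_e. *)
have logE i : area_sq (sqlen l) i * darea_log l v i =
    darea_sq (sqlen l) (dsqlen l v) i / 2.
  by rewrite /darea_log; field; rewrite gt_eqF ?area_sq_gt0.
have := logE 0%N; have := logE 1%N; have := logE 2%N; have := logE 3%N.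
rewrite !area_sq_projection // !darea_sq_projection // !big_cons !big_nil.
rewrite /X ![edge_faces _]/= ![(_, _).1]/= ![(_, _).2]/=.
move: (face_cos _) (dface_cos _ _) (darea_log _ _) => N dN h h3 h2 h1 h0.
lra.
Qed.

Lemma is_diff_EHR l : met l ->
  is_diff l (@EHR R) (fun v => \sum_e (2 * pi - 2 * dihedral l e) * v 0 e).
Proof.
move=> lM.
have cd (c : R) : is_diff l (fun=> c) (fun=> 0) by exact: is_diff_cst.
have dF e := is_diff_mulf (is_diff_subf (cd (2 * pi))
  (is_diff_scalef 2 (is_diff_dihedral e lM))) (is_diff_coord l e).
apply: is_diff_ext2 (is_diff_sumf _ dF) _ _ => // v.
(* The second term collects the variation of the angles, which the Schlaefli formula annihilates. *)
transitivity (\sum_e (2 * pi - 2 * dihedral l e) * v 0 e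
    + (- 2) * \sum_e l 0 e * ddihedral l v e).
  rewrite big_distrr -big_split /=; apply: eq_bigr => e _; ring.
by rewrite schlafli // mulr0 addr0.
Qed.

Lemma is_diff_total_length l :
  is_diff l (@total_length R) (fun v => \sum_e v 0 e).
Proof. by apply: is_diff_sumf => e; exact: is_diff_coord. Qed.

Lemma total_length_gt0 l : met l -> 0 < total_length l.
Proof.
move=> [l0 _]; rewrite /total_length big_ord_recl.
by rewrite ltr_wpDr // sumr_ge0 // => e _; exact: ltW.
Qed.

Definition grad_LEHR (e : 'I_6) l : R :=
  (2 * pi - 2 * dihedral l e) / total_length l - EHR l / total_length l ^+ 2.

Lemma is_diff_LEHR l : met l ->
  is_diff l (@LEHR R) (fun v => \sum_e grad_LEHR e l * v 0 e).
Proof.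
move=> lM; have L0 : total_length l != 0 by rewrite gt_eqF // total_length_gt0.
apply: is_diff_ext (is_diff_mulf (is_diff_EHR lM)
  (is_diff_invf L0 (is_diff_total_length l))) _ => v.
transitivity ((total_length l)^-1 * \sum_e (2 * pi - 2 * dihedral l e) * v 0 e
    - EHR l / total_length l ^+ 2 * \sum_e v 0 e); first by field.
rewrite !big_distrr -sumrB /=; apply: eq_bigr => e _.
by rewrite /grad_LEHR; field.
Qed.

Lemma total_volume_gt0 l : met l -> 0 < total_volume l.
Proof.
by move=> lM; rewrite total_volumeE // divr_gt0 // sqrtr_gt0; case/metP: lM.
Qed.

(** Partial derivative of the logarithm of the volume, which is proportional to the root of D: dD /
    ds_e is N at the opposite edge [5 - e], and the 2 in ds_e = 2 l_e dl_e cancels the 1/2 from the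
    root. *)
Definition log_dvolume (e : 'I_6) l : R :=
  face_cos (sqlen l) (5 - e) * l 0 e / gram_det (sqlen l).

Lemma is_diff_total_volume l : met l -> is_diff l (@total_volume R)
  (fun v => \sum_e (total_volume l * log_dvolume e l) * v 0 e).
Proof.
move=> lM; have [_ _ D0] := (metP l).1 lM.
have dF := @is_diff_comp1 _ _ Num.sqrt _ (fun y => gram_det (sqlen y)) _ l
  (is_derive1_sqrt D0) (is_diff_gram_det (is_diff_sqlen l)).
apply: near_is_diff (is_diff_ext (is_diff_scalef 3^-1 dF) _).
  by apply: filterS (met_near lM) => y yM; rewrite total_volumeE // mulrC.
move=> v; rewrite total_volumeE // /dgram_det !big_distrr /=.
apply: eq_bigr => e _; rewrite /log_dvolume /dsqlen inord_val.
have w0 : 0 < Num.sqrt (gram_det (sqlen l)) by rewrite sqrtr_gt0.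
have wE : gram_det (sqlen l) = Num.sqrt (gram_det (sqlen l)) ^+ 2.
  by rewrite sqr_sqrtr // ltW.
set w := Num.sqrt _ in w0 wE *; rewrite wE.
by field; rewrite gt_eqF.
Qed.

Definition grad_VEHR (e : 'I_6) l : R :=
  (2 * pi - 2 * dihedral l e - EHR l / 3 * log_dvolume e l)
  / total_volume l `^ 3^-1.

Lemma is_diff_VEHR l : met l ->
  is_diff l (@VEHR R) (fun v => \sum_e grad_VEHR e l * v 0 e).
Proof.
move=> lM; have W0 := total_volume_gt0 lM.
have U0 : total_volume l `^ 3^-1 != 0 by rewrite gt_eqF // powR_gt0.
have dU := @is_diff_comp1 _ _ (fun r => r `^ 3^-1) _ (@total_volume R) _ l
  (is_derive1_powR 3^-1 W0) (is_diff_total_volume lM).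
have dV := @is_diff_invf _ _ (fun y => total_volume y `^ 3^-1) _ l U0 dU.
have dF := is_diff_mulf (is_diff_EHR lM) dV.
apply: is_diff_ext dF _ => v.
have W0' : total_volume l != 0 by rewrite gt_eqF.
have UE : total_volume l `^ (3^-1 - 1) = total_volume l `^ 3^-1 / total_volume l.
  by rewrite powRB ?W0' ?implybT // powRr1 // ltW.
rewrite UE.
have -> : \sum_e (total_volume l * log_dvolume e l) * v 0 e =
    total_volume l * \sum_e log_dvolume e l * v 0 e.
  by rewrite big_distrr /=; apply: eq_bigr => e _; rewrite mulrA.
transitivity ((total_volume l `^ 3^-1)^-1 *
    (\sum_e (2 * pi - 2 * dihedral l e) * v 0 e
      - EHR l / 3 * \sum_e log_dvolume e l * v 0 e)).
  by field; rewrite U0 W0'.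
rewrite (big_distrr (EHR l / 3)) -sumrB big_distrr /=.
by apply: eq_bigr => e _; rewrite /grad_VEHR; field.
Qed.

End Curvature.

(** * Second order expansions and symmetric Hessians *)

Lemma partial_is_diff (R : realType) (n : nat) (f : 'rV[R]_n.+1 -> R)
    (g : 'I_n.+1 -> R) (y : 'rV[R]_n.+1) i :
  is_diff y f (fun v => \sum_i g i * v 0 i) -> partial i f y = g i.
Proof.
move=> fy; rewrite /partial deriveE; last exact: (@ex_diff _ _ _ _ _ _ _ fy).
rewrite (@diff_val _ _ _ _ _ _ _ fy) (bigD1 i) //= big1 => [|j ji].
  by rewrite mxE !eqxx mulr1 addr0.
by rewrite mxE eqxx (negPf ji) mulr0.
Qed.

Section SecondOrder.
Variables (R : realType) (n : nat).
Variables (f : 'rV[R]_n.+1 -> R) (g : 'I_n.+1 -> 'rV[R]_n.+1 -> R).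
Variables (H : 'M[R]_n.+1) (x : 'rV[R]_n.+1).

Hypothesis fd : \forall y \near x, is_diff y f (fun v => \sum_i g i y * v 0 i).
Hypothesis gd : forall i, is_diff x (g i) (fun v => \sum_j H i j * v 0 j).

Lemma is_diff_partial i :
  is_diff x (partial i f) (fun v => \sum_j H i j * v 0 j).
Proof.
apply: near_is_diff (gd i).
by apply: filterS fd => y fy; rewrite (partial_is_diff i fy).
Qed.

Lemma is_diff_has_second_partials : has_second_partials f x.
Proof.
split=> [|i j]; last first.
  exact/diff_derivable/(@ex_diff _ _ _ _ _ _ _ (is_diff_partial i)).
by apply: filterS fd => y fy i; apply/diff_derivable/(@ex_diff _ _ _ _ _ _ _ fy).
Qed.

Lemma is_diff_hessian : hessian f x = H.
Proof.
apply/matrixP => i j; rewrite mxE.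
exact: partial_is_diff j (is_diff_partial i).
Qed.

Hypothesis gx0 : forall i, g i x = 0.

Definition quad_form (v : 'rV[R]_n.+1) : R :=
  \sum_i \sum_j H i j * v 0 i * v 0 j.

Lemma critical_taylor2 e : 0 < e -> \forall v \near (0 : 'rV[R]_n.+1),
  `|f (x + v) - f x - 2^-1 * quad_form v| <= e * `|v| ^+ 2.
Proof.
move=> e0; apply: filterS (taylor2_near fd gd e0) => v.
rewrite (_ : \sum_i g i x * v 0 i = 0) ?subr0 //.
by rewrite big1 // => i _; rewrite gx0 mul0r.
Qed.

(** Along the ray of [v] the quadratic term dominates the Taylor error. Taking for [P] local
    extremality together with membership in [met], a [v] of suitable sign gives a contradiction. *)
Lemma quad_form_sign (P : set 'rV[R]_n.+1) v : (\forall y \near x, P y) ->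
  quad_form v != 0 -> exists2 y, P y & 0 < quad_form v * (f y - f x).
Proof.
move=> Px qv0.
have v0 : 0 < `|v|.
  rewrite normr_gt0; apply: contraNneq qv0 => ->; apply/eqP.
  by rewrite /quad_form big1 // => i _; rewrite big1 // => j _; rewrite !mxE !mulr0.
(* With this [e] the error at [t *: v] is at most half of the quadratic term. *)
pose e := `|quad_form v| / (4 * `|v| ^+ 2).
have e0 : 0 < e by rewrite divr_gt0 ?normr_gt0 // mulr_gt0 // exprn_gt0.
have P0 : \forall h \near (0 : 'rV[R]_n.+1), P (x + h).
  have := Px; rewrite (near_shift 0) /=; apply: filterS => h.
  by rewrite /= subr0 addrC.
have [r /= r0 rP] := (nbhs_ballP _ _).1 (filterI (critical_taylor2 e0) P0).
pose t := r / (2 * `|v|); have t0 : 0 < t by rewrite divr_gt0 // mulr_gt0.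
have tvr : ball 0 r (t *: v).
  rewrite -ball_normE /ball_ /= sub0r normrN normrZ gtr0_norm //.
  have -> : t * `|v| = r / 2 by rewrite /t; field; rewrite gt_eqF.
  by rewrite ltr_pdivrMr // ltr_pMr // ltr1n.
have [tP Ptv] := rP _ tvr; exists (x + t *: v) => //.
have qE : quad_form (t *: v) = t ^+ 2 * quad_form v.
  rewrite /quad_form big_distrr; apply: eq_bigr => i _ /=.
  by rewrite big_distrr; apply: eq_bigr => j _; rewrite /= !mxE; ring.
move: tP; rewrite qE normrZ (gtr0_norm t0).
have -> : e * (t * `|v|) ^+ 2 = t ^+ 2 * `|quad_form v| / 4.
  by rewrite /e; field; rewrite gt_eqF.
move: (f _ - f x) (quad_form v) qv0 => d q q0.
have q2 : 0 < t ^+ 2 by rewrite exprn_gt0.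
rewrite ler_norml => /andP[lo hi].
case: (ltrgtP q 0) q0 lo hi => // qs _.
  rewrite ltr0_norm // => lo hi; rewrite nmulr_rgt0 //.
  have : t ^+ 2 * q < 0 by rewrite pmulr_rlt0.
  lra.
rewrite gtr0_norm // => lo hi; rewrite pmulr_rgt0 //.
have : 0 < t ^+ 2 * q by rewrite mulr_gt0.
lra.
Qed.

End SecondOrder.

(** * Spectrum of the matrices on edges invariant under relabelling the vertices *)

Section InvariantMatrices.
Variable R : realType.
Variables a b c : R.
Implicit Types v : 'rV[R]_6.

(** The general invariant matrix: permutations of the vertices have three orbits on pairs of edges,
    namely equal, opposite and adjacent ones. *)
Definition edge_mx : 'M[R]_6 :=
  \matrix_(i, j) (a * (j == i)%:R + b * (j == rev_ord i)%:R + c).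

Lemma edge_mx_sum v i : \sum_j edge_mx i j * v 0 j =
  a * v 0 i + b * v 0 (rev_ord i) + c * \sum_j v 0 j.
Proof.
rewrite (eq_bigr (fun j => a * ((j == i)%:R * v 0 j)
    + b * ((j == rev_ord i)%:R * v 0 j) + c * v 0 j)); last first.
  by move=> j _; rewrite mxE; ring.
rewrite !big_split -!big_distrr /=; congr (_ * _ + _ * _ + _).
  rewrite (bigD1 i) //= eqxx mul1r big1 ?addr0 // => j /negPf ->.
  by rewrite mul0r.
rewrite (bigD1 (rev_ord i)) //= eqxx mul1r big1 ?addr0 // => j /negPf ->.
by rewrite mul0r.
Qed.

Lemma edge_mx_sym i j : edge_mx i j = edge_mx j i.
Proof.
rewrite !mxE (eq_sym j i); congr (_ + _ * _%:R + _).
by rewrite -(inj_eq rev_ord_inj) rev_ordK eq_sym.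
Qed.

Lemma mul_edge_mx m (U : 'M[R]_(m, 6)) i j : (U *m edge_mx) i j =
  a * U i j + b * U i (rev_ord j) + c * \sum_k U i k.
Proof.
transitivity (\sum_k edge_mx j k * row i U 0 k).
  by rewrite mxE; apply: eq_bigr => k _; rewrite edge_mx_sym mulrC [row _ _ _ _]mxE.
rewrite edge_mx_sum ![row _ _ _ _]mxE; congr (_ + c * _).
by apply: eq_bigr => k _; rewrite mxE.
Qed.

Lemma sum_edges_ord (F : 'I_6 -> R) : \sum_e F e =
  F (inord 0) + F (inord 1) + F (inord 2) + F (inord 3) + F (inord 4) + F (inord 5).
Proof.
rewrite -(sum_edges (fun n => F (inord n))).
by apply: eq_bigr => e _; rewrite inord_val.
Qed.

Lemma rev_edge i : (i < 6)%N -> rev_ord (inord i : 'I_6) = inord (5 - i).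
Proof. by move=> i6; apply: val_inj; rewrite /= !inordK // ltnS leq_subr. Qed.

Lemma edge_ind (P : 'I_6 -> Prop) :
  (forall i, (i < 6)%N -> P (inord i)) -> forall e, P e.
Proof. by move=> Pi e; rewrite -(inord_val e); apply: Pi. Qed.

(** Vanishing row sums express scale invariance at a critical point. The inequalities that follow
    make the eigenvalues a - b, a + b and 0 pairwise distinct. *)
Hypothesis abc : a + b + 6 * c = 0.
Hypotheses (ab0 : a + b != 0) (amb0 : a - b != 0) (b0 : b != 0).

(** The second part adds up the six eigenvalue equations and uses the vanishing row sums; for
    nonzero [lam] the coordinates of [v] then have sum 0. *)
Lemma eigen_edge_mxP v lam : (v <= eigenspace edge_mx lam)%MS ->
  (forall i, a * v 0 i + b * v 0 (rev_ord i) + c * \sum_j v 0 j = lam * v 0 i) /\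
  lam * \sum_j v 0 j = 0.
Proof.
move=> /eigenspaceP vE.
have E i : a * v 0 i + b * v 0 (rev_ord i) + c * \sum_j v 0 j = lam * v 0 i.
  by have := mul_edge_mx v 0 i; rewrite vE mxE => <-.
split=> //; rewrite big_distrr /= -(eq_bigr _ (fun i _ => E i)).
rewrite !big_split -!big_distrr /= sumr_const card_ord -mulr_natr.
rewrite [X in b * X](reindex_inj rev_ord_inj) /=.
under [X in b * X]eq_bigr do rewrite rev_ordK.
move: (\sum_j v 0 j) => S.
transitivity ((a + b + 6 * c) * S); first by ring.
by rewrite abc mul0r.
Qed.

Lemma eigen_edge_mx_sub m (U : 'M[R]_(m, 6)) lam :
  (forall i j, a * U i j + b * U i (rev_ord j) + c * \sum_k U i k = lam * U i j) ->
  (U <= eigenspace edge_mx lam)%MS.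
Proof.
by move=> UE; apply/eigenspaceP/matrixP => i j; rewrite mul_edge_mx UE mxE.
Qed.

Lemma span_rowsE m (s : seq (seq R)) (i : 'I_m) n : (n < 6)%N ->
  span_rows m s i (inord n) = nth 0 (nth [::] s i) n.
Proof. by move=> n6; rewrite mxE inordK. Qed.

Lemma eigenspace_edge_mx1 : (eigenspace edge_mx (a - b) :=: V1 R)%MS.
Proof.
apply/eqmxP/andP; split; last first.
  apply: eigen_edge_mx_sub => i; apply: edge_ind => j j6.
  rewrite sum_edges_ord rev_edge // !span_rowsE ?ltnS ?leq_subr //.
  by case: i j j6 => [[|[|[|//]]] ?] [|[|[|[|[|[|//]]]]]] _; rewrite /=; ring.
apply/row_subP => r; move: (row r _) (row_sub r (eigenspace edge_mx (a - b))).
move=> v /eigen_edge_mxP[vE /eqP]; rewrite mulf_eq0 (negPf amb0) => /eqP S0.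
(* As the sum vanishes, the equation at [i] reduces to b v_(5-i) = - b v_i. *)
have vr i : (i < 6)%N -> v 0 (inord (5 - i)) = - v 0 (inord i).
  move=> i6; have := vE (inord i); rewrite S0 mulr0 addr0 rev_edge // => e.
  by apply: (mulfI b0); rewrite mulrN; move: e; lra.
pose w : 'rV[R]_3 := \row_i v 0 (inord i).
suff -> : v = w *m V1 R by exact: submxMl.
apply/rowP; apply: edge_ind => j j6; rewrite mxE !big_ord_recl big_ord0.
rewrite !span_rowsE // ![w _ _]mxE /= /bump /=.
have := vr 0%N isT; have := vr 1%N isT; have := vr 2%N isT.
rewrite ![(5 - _)%N]/= => v3 v4 v5.
by case: j j6 => [|[|[|[|[|[|//]]]]]] _; rewrite ?v3 ?v4 ?v5 /=; ring.
Qed.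

Lemma eigenspace_edge_mx2 : (eigenspace edge_mx (a + b) :=: V2 R)%MS.
Proof.
apply/eqmxP/andP; split; last first.
  apply: eigen_edge_mx_sub => i; apply: edge_ind => j j6.
  rewrite sum_edges_ord rev_edge // !span_rowsE ?ltnS ?leq_subr //.
  by case: i j j6 => [[|[|//]] ?] [|[|[|[|[|[|//]]]]]] _; rewrite /=; field.
apply/row_subP => r; move: (row r _) (row_sub r (eigenspace edge_mx (a + b))).
move=> v /eigen_edge_mxP[vE /eqP]; rewrite mulf_eq0 (negPf ab0) => /eqP S0.
have vr i : (i < 6)%N -> v 0 (inord (5 - i)) = v 0 (inord i).
  move=> i6; have := vE (inord i); rewrite S0 mulr0 addr0 rev_edge // => e.
  by apply: (mulfI b0); move: e; lra.
(* The coefficients are read off from the coordinates 0 and 1; the coordinate 2 follows from the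
   vanishing sum, the rest by symmetry. *)
pose w : 'rV[R]_2 := \row_i (if i == 0 then v 0 (inord 1) + v 0 (inord 0) / 2
   else v 0 (inord 0)).
suff -> : v = w *m V2 R by exact: submxMl.
apply/rowP; apply: edge_ind => j j6; rewrite mxE !big_ord_recl big_ord0.
rewrite !span_rowsE // ![w _ _]mxE /= /bump /=.
move: S0; rewrite sum_edges_ord.
have := vr 0%N isT; have := vr 1%N isT; have := vr 2%N isT.
rewrite ![(5 - _)%N]/= => v3 v4 v5; rewrite v3 v4 v5 => S0.
by case: j j6 => [|[|[|[|[|[|//]]]]]] _; rewrite ?v3 ?v4 ?v5 /=; lra.
Qed.

Lemma eigenspace_edge_mx0 : (eigenspace edge_mx 0 :=: V0 R)%MS.
Proof.
apply/eqmxP/andP; split; last first.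
  apply: eigen_edge_mx_sub => i; apply: edge_ind => j j6.
  rewrite sum_edges_ord rev_edge // !span_rowsE ?ltnS ?leq_subr //.
  rewrite mul0r -[RHS]abc.
  by case: i j j6 => [[|//] ?] [|[|[|[|[|[|//]]]]]] _; rewrite /=; ring.
apply/row_subP => r; move: (row r _) (row_sub r (eigenspace edge_mx 0)).
move=> v /eigen_edge_mxP[vE _].
(* Subtract the equations at opposite edges and cancel a - b; afterwards compare [i] with the edge 0
   and cancel a + b. *)
have vr i : v 0 (rev_ord i) = v 0 i.
  have := vE (rev_ord i); have := vE i; rewrite rev_ordK !mul0r => e1 e2.
  by apply: (mulfI amb0); move: e1 e2; lra.
have vc i : v 0 i = v 0 (inord 0).
  have := vE (inord 0); have := vE i; rewrite !vr !mul0r => e1 e2.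
  by apply: (mulfI ab0); move: e1 e2; lra.
pose w : 'rV[R]_1 := \row_i v 0 (inord 0).
suff -> : v = w *m V0 R by exact: submxMl.
apply/rowP; apply: edge_ind => j j6; rewrite mxE !big_ord_recl big_ord0.
rewrite !span_rowsE // ![w _ _]mxE vc.
by case: j j6 => [|[|[|[|[|[|//]]]]]] _; rewrite /= addr0 mulr1.
Qed.

Lemma quad_form_edge_mx v : quad_form edge_mx v =
  a * \sum_i v 0 i ^+ 2 + b * \sum_i v 0 i * v 0 (rev_ord i)
  + c * (\sum_i v 0 i) ^+ 2.
Proof.
set S := \sum_i v 0 i.
rewrite /quad_form (eq_bigr (fun i => a * v 0 i ^+ 2
   + b * (v 0 i * v 0 (rev_ord i)) + c * (v 0 i * S))); last first.
  move=> i _.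
  transitivity (v 0 i * (a * v 0 i + b * v 0 (rev_ord i) + c * S)); last by ring.
  rewrite -edge_mx_sum [RHS]big_distrr /=.
  by apply: eq_bigr => j _; ring.
by rewrite !big_split -!big_distrr /= -big_distrl /= -/S -expr2.
Qed.

(** Twice the form is (a + b)(Q + X) + (a - b)(Q - X), where Q + X and Q - X are nonnegative as half
    sums of squares of v_i + v_i' and v_i - v_i', i' being opposite to i. *)
Lemma quad_form_edge_mx_ge v m : m <= a - b -> m <= a + b ->
  \sum_i v 0 i = 0 -> m * \sum_i v 0 i ^+ 2 <= quad_form edge_mx v.
Proof.
move=> m1 m2 S0; rewrite quad_form_edge_mx S0 expr0n mulr0 addr0.
set Q := \sum_i _ ^+ 2; set X := \sum_i _ * _.
have QE : Q = \sum_i v 0 (rev_ord i) ^+ 2.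
  by rewrite /Q [LHS](reindex_inj rev_ord_inj).
have p1 : 0 <= Q + X.
  have : 0 <= \sum_i (v 0 i + v 0 (rev_ord i)) ^+ 2.
    by apply: sumr_ge0 => i _; exact: sqr_ge0.
  rewrite (_ : \sum_i _ = Q + 2 * X + Q); first lra.
  by rewrite {2}QE big_distrr -!big_split; apply: eq_bigr => i _ /=; ring.
have p2 : 0 <= Q - X.
  have : 0 <= \sum_i (v 0 i - v 0 (rev_ord i)) ^+ 2.
    by apply: sumr_ge0 => i _; exact: sqr_ge0.
  rewrite (_ : \sum_i _ = Q + (- 2) * X + Q); first lra.
  by rewrite {2}QE big_distrr -!big_split; apply: eq_bigr => i _ /=; ring.
have := mulr_ge0 p1 (_ : 0 <= a + b - m); have := mulr_ge0 p2 (_ : 0 <= a - b - m).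
rewrite !subr_ge0 => /(_ m1) h1 /(_ m2) h2; move: h1 h2; lra.
Qed.

End InvariantMatrices.

(** * The regular tetrahedron *)

Section EqualLengths.
Variables (R : realType) (k : R).
Hypothesis k0 : 0 < k.
Implicit Types v : 'rV[R]_6.
Local Notation x := (equal_length k).
Local Notation theta := (2 * pi - 2 * acos (1 / 3) : R).

Let kN0 : k != 0. Proof. by rewrite gt_eqF. Qed.

Lemma equal_sqlen n : sqlen x n = k ^+ 2.
Proof. by rewrite /sqlen mxE. Qed.

Lemma equal_dsqlen v n : dsqlen x v n = 2 * k * v 0 (inord n).
Proof. by rewrite /dsqlen mxE. Qed.

Lemma equal_area_sq i : area_sq (sqlen x) i = 3 / 4 * k ^+ 4.
Proof.
by case: i => [|[|[|i]]]; rewrite /area_sq /heron !equal_sqlen; field.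
Qed.

Lemma equal_face_cos e : face_cos (sqlen x) e = k ^+ 4 / 4.
Proof.
by case: e => [|[|[|[|[|e]]]]]; rewrite /face_cos /cosnum !equal_sqlen; field.
Qed.

Lemma equal_gram_det : gram_det (sqlen x) = k ^+ 6 / 2.
Proof. by rewrite /gram_det !equal_sqlen; field. Qed.

Lemma equal_met : met x.
Proof.
apply/metP; split=> [e||]; first by rewrite mxE.
  by rewrite equal_area_sq mulr_gt0 ?exprn_gt0 // divr_gt0.
by rewrite equal_gram_det divr_gt0 ?exprn_gt0.
Qed.

Lemma equal_dihedral e : dihedral x e = acos (1 / 3).
Proof.
rewrite dihedralE; last exact: equal_met.
rewrite /cos_dihedral !equal_area_sq equal_face_cos -expr2 sqr_sqrtr.
  by congr acos; field.
by rewrite mulr_ge0 ?exprn_ge0 ?divr_ge0 // ltW.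
Qed.

Lemma equal_EHR : EHR x = 6 * k * theta.
Proof.
rewrite /EHR (eq_bigr (fun=> k * theta)) => [|e _].
  by rewrite sumr_const card_ord -[LHS]mulr_natl mulrA.
by rewrite /edge_curv equal_dihedral mxE mulrC.
Qed.

Lemma equal_total_length : total_length x = 6 * k.
Proof.
rewrite /total_length (eq_bigr (fun=> k)) => [|e _]; last by rewrite mxE.
by rewrite sumr_const card_ord -[LHS]mulr_natl.
Qed.

Lemma equal_log_dvolume e : log_dvolume e x = (2 * k)^-1.
Proof. by rewrite /log_dvolume equal_face_cos equal_gram_det mxE; field. Qed.

Lemma equal_grad_LEHR e : grad_LEHR e x = 0.
Proof.
rewrite /grad_LEHR equal_dihedral equal_total_length equal_EHR.
by field.
Qed.

Lemma equal_grad_VEHR e : grad_VEHR e x = 0.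
Proof.
rewrite /grad_VEHR equal_dihedral equal_log_dvolume equal_EHR.
rewrite (_ : _ - _ = 0) ?mul0r //.
by field.
Qed.

Lemma equal_ddihedral v (e : 'I_6) : ddihedral x v e =
  Num.sqrt 2 / (3 * k) * (2 * v 0 e + 4 * v 0 (rev_ord e) - \sum_i v 0 i).
Proof.
have sE : Num.sqrt (k ^+ 6 / 2 * k ^+ 2) = k ^+ 4 / Num.sqrt 2.
  have -> : k ^+ 6 / 2 * k ^+ 2 = (k ^+ 4) ^+ 2 / 2 by field.
  by rewrite sqrtrM ?sqr_ge0 // sqrtr_sqr ger0_norm ?exprn_ge0 ?ltW // sqrtrV.
have r0 : Num.sqrt 2 != 0 :> R by rewrite gt_eqF // sqrtr_gt0.
have rr : Num.sqrt 2 ^+ 2 = 2 :> R by rewrite sqr_sqrtr.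
elim/edge_ind: e => e e6; rewrite /ddihedral rev_edge // sum_edges_ord inordK //.
rewrite equal_sqlen equal_gram_det sE /darea_log !equal_area_sq equal_face_cos.
case: e e6 => [|[|[|[|[|[|//]]]]]] _;
  rewrite /= /dcosnum /dheron !equal_sqlen !equal_dsqlen.
all: field.
all: by rewrite ?kN0 ?r0.
Qed.

Lemma equal_dEHR v :
  \sum_i (2 * pi - 2 * dihedral x i) * v 0 i = theta * \sum_i v 0 i.
Proof. by rewrite big_distrr; apply: eq_bigr => i _; rewrite equal_dihedral. Qed.

(** At [x], [EHR] is [theta] times the total length, so the terms in [theta] cancel and only - 2
    dbeta_e / (6 k) is left. *)
Lemma is_diff_grad_LEHR e : is_diff x (grad_LEHR e) (fun v =>
  \sum_j edge_mx (- (2 * (Num.sqrt 2 / (9 * k ^+ 2))))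
    (- (4 * (Num.sqrt 2 / (9 * k ^+ 2)))) (Num.sqrt 2 / (9 * k ^+ 2)) e j * v 0 j).
Proof.
have cd (c : R) : is_diff x (fun=> c) (fun=> 0) by exact: is_diff_cst.
have L0 : total_length x != 0 by rewrite gt_eqF // total_length_gt0 //; exact: equal_met.
have dL := is_diff_invf L0 (is_diff_total_length x).
have dE := is_diff_EHR equal_met.
have dB := is_diff_subf (cd (2 * pi)) (is_diff_scalef 2 (is_diff_dihedral e equal_met)).
apply: is_diff_ext2 (is_diff_subf (is_diff_mulf dB dL)
  (is_diff_mulf dE (is_diff_mulf dL dL))) _ _.
  by move=> y; rewrite /grad_LEHR expr2 invfM.
move=> v; rewrite edge_mx_sum equal_ddihedral equal_dihedral equal_EHR equal_total_length.
rewrite equal_dEHR; move: (\sum_i v 0 i) => S.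
by field.
Qed.

Lemma is_diff_log_dvolume e : is_diff x (log_dvolume e) (fun v =>
  (2^-1 * \sum_i v 0 i - 5 / 2 * v 0 e - v 0 (rev_ord e)) / k ^+ 2).
Proof.
have D0 : gram_det (sqlen x) != 0 by rewrite equal_gram_det mulf_neq0 ?expf_neq0.
have sd := is_diff_sqlen x.
have dD := @is_diff_invf _ _ (fun y => gram_det (sqlen y)) _ x D0 (is_diff_gram_det sd).
have dN := is_diff_mulf (is_diff_face_cos sd (5 - e)) (is_diff_coord x e).
apply: is_diff_ext2 (is_diff_mulf dN dD) _ _ => // v.
have -> : dgram_det (sqlen x) (dsqlen x v) = k ^+ 5 / 2 * \sum_i v 0 i.
  rewrite big_distrr; apply: eq_bigr => i _ /=.
  by rewrite equal_face_cos equal_dsqlen inord_val; field.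
rewrite equal_gram_det equal_face_cos mxE.
elim/edge_ind: e {dN} => e e6; rewrite rev_edge // sum_edges_ord inordK //.
case: e e6 => [|[|[|[|[|[|//]]]]]] _;
  rewrite /= /dcosnum !equal_sqlen !equal_dsqlen.
all: by field.
Qed.

Lemma is_diff_grad_VEHR e : let u := (total_volume x `^ 3^-1)^-1 in
  is_diff x (grad_VEHR e) (fun v =>
  \sum_j edge_mx (u / k * (5 * theta - 4 * Num.sqrt 2 / 3))
    (u / k * (2 * theta - 8 * Num.sqrt 2 / 3))
    (u / k * (- (7 * theta / 6) + 2 * Num.sqrt 2 / 3)) e j * v 0 j).
Proof.
move=> u; have cd (c : R) : is_diff x (fun=> c) (fun=> 0) by exact: is_diff_cst.
have W0 : 0 < total_volume x by apply: total_volume_gt0; exact: equal_met.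
have U0 : total_volume x `^ 3^-1 != 0 by rewrite gt_eqF // powR_gt0.
have dU := @is_diff_comp1 _ _ (fun r => r `^ 3^-1) _ (@total_volume R) _ x
  (is_derive1_powR 3^-1 W0) (is_diff_total_volume equal_met).
have dV := @is_diff_invf _ _ (fun y => total_volume y `^ 3^-1) _ x U0 dU.
have dE := is_diff_scalef 3^-1 (is_diff_EHR equal_met).
have dB := is_diff_subf (cd (2 * pi)) (is_diff_scalef 2 (is_diff_dihedral e equal_met)).
have dn := is_diff_subf dB (is_diff_mulf dE (is_diff_log_dvolume e)).
apply: is_diff_ext2 (is_diff_mulf dn dV) _ _.
  by move=> y; rewrite /grad_VEHR [_ / 3]mulrC.
move=> v; rewrite edge_mx_sum equal_ddihedral equal_dihedral equal_EHR equal_log_dvolume.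
rewrite equal_dEHR -/u; move: (\sum_i v 0 i) => S.
(* The numerator of [grad_VEHR] vanishes at [x], so the variation of the volume factor drops out. *)
rewrite (_ : 2 * pi - _ - _ = 0) ?mul0r ?add0r; last by field.
by field.
Qed.

Lemma equal_total_volume : total_volume x = k ^+ 3 / (3 * Num.sqrt 2).
Proof.
rewrite total_volumeE; last exact: equal_met.
rewrite equal_gram_det (_ : k ^+ 6 = (k ^+ 3) ^+ 2); last by rewrite -exprM.
rewrite sqrtrM ?sqr_ge0 // sqrtr_sqr ger0_norm ?exprn_ge0 ?ltW // sqrtrV //.
by rewrite invfM mulrA mulrAC.
Qed.

End EqualLengths.

(** * Rigidity and scaling *)

Section Rigidity.
Variable R : realType.
Implicit Types l : 'rV[R]_6.

Lemma equal_dihedral_equal_length l b : met l ->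
  (forall e, dihedral l e = b) -> exists2 k : R, 0 < k & l = equal_length k.
Proof.
move=> lM lb; have [l0 _ D0] := (metP l).1 lM.
pose r i := Num.sqrt (area_sq (sqlen l) i).
have r0 i : 0 < r i by rewrite sqrtr_gt0 area_sq_gt0.
have rr i : area_sq (sqlen l) i = r i ^+ 2.
  by rewrite sqr_sqrtr // ltW // area_sq_gt0.
have NE e : (e < 6)%N ->
    face_cos (sqlen l) e = cos b * (r (edge_faces e).1 * r (edge_faces e).2).
  move=> e6; have pq0 : 0 < r (edge_faces e).1 * r (edge_faces e).2 by rewrite mulr_gt0.
  have := lb (inord e); rewrite dihedralE // inordK // => <-.
  have ce : face_cos (sqlen l) e =
      cos_dihedral (sqlen l) e * (r (edge_faces e).1 * r (edge_faces e).2).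
    by rewrite /cos_dihedral -/(r _) -/(r _) divfK // gt_eqF.
  rewrite acosK // in_itv /= -ler_norml -(@expr_le1 _ 2) // real_normK ?num_real //.
  have := sqr_face_cos_lt lM e6; rewrite ce !rr -exprMn => h.
  by apply/ltW; rewrite -(ltr_pM2r (exprn_gt0 2 pq0)) mul1r -exprMn.
pose T := r 0%N + r 1%N + r 2%N + r 3%N.
(* The projection identity divided by [r i], with cos b * r_i added to both sides. *)
have rE i : (i < 4)%N -> (1 + cos b) * r i = cos b * T.
  move=> i4; apply: (mulfI (lt0r_neq0 (r0 i))); rewrite /T.
  have := area_sq_projection (sqlen l) i4; rewrite rr.
  case: i i4 => [|[|[|[|//]]]] _; rewrite !big_cons big_nil !NE //=;
    move: (r 0%N) (r 1%N) (r 2%N) (r 3%N) (cos b) => p q s t c h; lra.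
(* Otherwise cos b = -1 and [rE] gives T = 0, although T is a sum of positive numbers. *)
have c1 : 1 + cos b != 0.
  apply/eqP => c1; have := rE 0%N isT; rewrite c1 mul0r => h.
  have T0 : 0 < T by rewrite /T !addr_gt0.
  by move: h c1; move=> /esym/eqP; rewrite mulf_eq0 (gt_eqF T0) orbF => /eqP; lra.
have rc i : (i < 4)%N -> r i = r 0%N.
  by move=> i4; apply: (mulfI c1); rewrite !rE.
exists (l 0 (inord 0)) => //.
have sE e : (e < 6)%N ->
    gram_det (sqlen l) * sqlen l e = r 0%N ^+ 4 * (1 - cos b ^+ 2).
  move=> e6; rewrite -jacobi_identity // !rr NE //.
  rewrite (rc (edge_faces e).1) ?(rc (edge_faces e).2); first by ring.
    by case: e e6 => [|[|[|[|[|]]]]].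
  by case: e e6 => [|[|[|[|[|]]]]].
apply/rowP; apply: edge_ind => e e6; rewrite mxE.
apply: (@pexpIrn _ 2) => //; rewrite ?nnegrE ?ltW //.
apply: (mulfI (lt0r_neq0 D0)); rewrite -!/(sqlen l _).
by rewrite !sE.
Qed.

Lemma L_EinsteinP l :
  L_Einstein l <-> exists2 k : R, 0 < k & l = equal_length k.
Proof.
split=> [[lM [lam lamE]]|[k k0 ->]].
  apply: (equal_dihedral_equal_length (b := (2 * pi - lam) / 2) lM) => e.
  have := lamE e; rewrite /edge_curv => /(mulIf (lt0r_neq0 (lM.1 e))); lra.
split; first exact: equal_met.
exists (2 * pi - 2 * acos (1 / 3)) => e.
by rewrite /edge_curv equal_dihedral.
Qed.

Lemma critical_LEHR l : met l ->
  (critical_point (@LEHR R) l <-> exists2 k : R, 0 < k & l = equal_length k).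
Proof.
move=> lM; have dL := is_diff_LEHR lM.
have dE : 'd (@LEHR R) l = (fun v => \sum_e grad_LEHR e l * v 0 e) :> ('rV[R]_6 -> R).
  exact: (@diff_val _ _ _ _ _ _ _ dL).
split=> [[_ cr]|[k k0 lk]]; last first.
  split; first exact: (@ex_diff _ _ _ _ _ _ _ dL).
  move=> v; rewrite dE big1 // => e _.
  by rewrite lk equal_grad_LEHR // mul0r.
have g0 e : grad_LEHR e l = 0.
  have := cr (delta_mx 0 e); rewrite dE (bigD1 e) //= big1 => [|j je].
    by rewrite mxE !eqxx mulr1 addr0.
  by rewrite mxE eqxx (negPf je) mulr0.
apply: (equal_dihedral_equal_length (b := pi - EHR l / total_length l / 2) lM) => e.
have L0 : total_length l != 0 by rewrite gt_eqF // total_length_gt0.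
have := g0 e; rewrite /grad_LEHR => h.
have : total_length l * ((2 * pi - 2 * dihedral l e) / total_length l
   - EHR l / total_length l ^+ 2) = 0 by rewrite h mulr0.
rewrite (_ : _ * _ = 2 * pi - 2 * dihedral l e - EHR l / total_length l); last by field.
lra.
Qed.

End Rigidity.

(** * Behaviour under scaling of all lengths *)

Section Scaling.
Variable R : realType.
Implicit Types l : 'rV[R]_6.
Variables (c : R) (c0 : 0 < c).

Lemma sqlen_scale l n : sqlen (c *: l) n = c ^+ 2 * sqlen l n.
Proof. by rewrite /sqlen mxE exprMn. Qed.

Lemma area_sq_scale l i :
  area_sq (sqlen (c *: l)) i = (c ^+ 2) ^+ 2 * area_sq (sqlen l) i.
Proof.
by case: i => [|[|[|i]]]; rewrite /area_sq /heron !sqlen_scale; field.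
Qed.

Lemma face_cos_scale l e :
  face_cos (sqlen (c *: l)) e = (c ^+ 2) ^+ 2 * face_cos (sqlen l) e.
Proof.
by case: e => [|[|[|[|[|e]]]]]; rewrite /face_cos /cosnum !sqlen_scale; field.
Qed.

Lemma gram_det_scale l :
  gram_det (sqlen (c *: l)) = (c ^+ 3) ^+ 2 * gram_det (sqlen l).
Proof. by rewrite /gram_det !sqlen_scale; field. Qed.

Lemma met_scale l : met l -> met (c *: l).
Proof.
move=> /metP[l0 A0 D0]; apply/metP; split=> [e||].
- by rewrite mxE mulr_gt0.
- by rewrite area_sq_scale mulr_gt0 // !exprn_gt0.
- by rewrite gram_det_scale mulr_gt0 // !exprn_gt0.
Qed.

Lemma dihedral_scale l e : met l -> dihedral (c *: l) e = dihedral l e.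
Proof.
move=> lM; rewrite !dihedralE //; last exact: met_scale.
rewrite /cos_dihedral face_cos_scale !area_sq_scale !(sqrtrM _ (sqr_ge0 (c ^+ 2))).
rewrite !sqrtr_sqr (ger0_norm (sqr_ge0 c)) mulrACA -expr2 -mulf_div divff ?mul1r //.
by rewrite !expf_neq0 // gt_eqF.
Qed.

Lemma VEHR_scale l : met l -> VEHR (c *: l) = VEHR l.
Proof.
move=> lM; have cl := met_scale lM.
have EE : EHR (c *: l) = c * EHR l.
  rewrite /EHR big_distrr; apply: eq_bigr => e _ /=.
  by rewrite /edge_curv dihedral_scale // mxE mulrCA.
have VV : total_volume (c *: l) `^ 3^-1 = c * total_volume l `^ 3^-1.
  have -> : total_volume (c *: l) = c ^+ 3 * total_volume l.
    rewrite !total_volumeE // gram_det_scale sqrtrM ?sqr_ge0 // sqrtr_sqr.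
    by rewrite ger0_norm ?exprn_ge0 ?ltW // mulrA.
  rewrite powRM ?exprn_ge0 ?ltW ?total_volume_gt0 //.
  by rewrite -powR_mulrn ?ltW // -powRrM mulfV // powRr1 // ltW.
by rewrite /VEHR EE VV -mulf_div divff ?gt_eqF // mul1r.
Qed.

End Scaling.

(** * Numerical bounds and closed forms of the eigenvalues *)

Section Constants.
Variable R : realType.

Lemma sqrt2_gt0 : 0 < Num.sqrt 2 :> R.
Proof. by rewrite sqrtr_gt0. Qed.

Lemma sqrt2_lt : Num.sqrt 2 < 3 / 2 :> R.
Proof.
by rewrite -(ltr_pXn2r (n := 2)) ?nnegrE ?sqrtr_ge0 // sqr_sqrtr //; lra.
Qed.

Lemma acos_third_lt : acos (1 / 3) < pi / 2 :> R.
Proof.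
have t1 : -1 <= (1 / 3 : R) <= 1 by lra.
rewrite -ltr_cos ?in_itv /= ?acos_ge0 ?acos_lepi ?divr_ge0 ?pi_ge0 //.
  by rewrite cos_pihalf acosK ?in_itv //= divr_gt0.
by have := pi_ge0 R; lra.
Qed.

(** Writing theta for the right-hand side, this and sqrt 2 < 3/2 give 2 theta > 8 sqrt 2 / 3 and 7
    theta > 4 sqrt 2, the signs required for the Hessian of [VEHR]. *)
Lemma curvature_gt2 : 2 < 2 * pi - 2 * acos (1 / 3) :> R.
Proof. by have := acos_third_lt; have := pi_ge2 R; lra. Qed.

Lemma powR2_7_6 : 2 `^ (7 / 6) = 2 * 2 `^ (1 / 6) :> R.
Proof.
rewrite (_ : 7 / 6 = 1 + 1 / 6); last by field.
by rewrite powRD ?powRr1 // pnatr_eq0 implybT.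
Qed.

Lemma powR2_3_2 : 2 `^ (3 / 2) = 2 * Num.sqrt 2 :> R.
Proof.
rewrite (_ : 3 / 2 = 1 + 2^-1); last by field.
by rewrite powRD ?powRr1 ?powR12_sqrt // pnatr_eq0 implybT.
Qed.

Variables (k : R) (k0 : 0 < k).

Lemma equal_volume_root : (total_volume (equal_length k) `^ 3^-1)^-1 =
  2 `^ (1 / 6) * 3 `^ (1 / 3) / k.
Proof.
pose s : R := 2 `^ (1 / 6); pose t : R := 3 `^ (1 / 3).
have s0 : 0 < s by rewrite powR_gt0.
have t0 : 0 < t by rewrite powR_gt0.
have s3 : s ^+ 3 = Num.sqrt 2.
  rewrite -powR_mulrn ?ltW // -powRrM (_ : 1 / 6 * 3%:R = 2^-1); last by field.
  by rewrite powR12_sqrt.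
have t3 : t ^+ 3 = 3.
  rewrite -powR_mulrn ?ltW // -powRrM (_ : 1 / 3 * 3%:R = 1); last by field.
  by rewrite powRr1.
(* The volume is k^3 / (3 sqrt 2), with s^3 = sqrt 2 and t^3 = 3. *)
have -> : total_volume (equal_length k) = (k / (s * t)) ^+ 3.
  by rewrite equal_total_volume // expr_div_n exprMn s3 t3 [_ * 3]mulrC.
rewrite -powR_mulrn; last by rewrite divr_ge0 ?mulr_ge0 // ltW.
rewrite -powRrM mulfV // powRr1; last by rewrite divr_ge0 ?mulr_ge0 // ltW.
by rewrite invf_div.
Qed.

(** Puts the stated constant into the shape of a - b for the coefficients in [is_diff_grad_VEHR];
    the next lemma does so for a + b. *)
Lemma lambda1_VEHR_root : lambda1_VEHR k =
  (total_volume (equal_length k) `^ 3^-1)^-1 / k *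
  (3 * (2 * pi - 2 * acos (1 / 3)) + 4 * Num.sqrt 2 / 3).
Proof.
rewrite equal_volume_root /lambda1_VEHR powR2_7_6 powR2_3_2.
have -> : 3 `^ (- (2 / 3)) = 3 `^ (1 / 3) / 3 :> R.
  rewrite (_ : - (2 / 3) = 1 / 3 - 1); last by field.
  by rewrite powRB ?powRr1 // pnatr_eq0 implybT.
by field; rewrite gt_eqF.
Qed.

Lemma lambda2_VEHR_root : lambda2_VEHR k =
  (total_volume (equal_length k) `^ 3^-1)^-1 / k *
  (7 * (2 * pi - 2 * acos (1 / 3)) - 4 * Num.sqrt 2).
Proof.
rewrite equal_volume_root /lambda2_VEHR powR2_7_6 powR2_3_2.
by field; rewrite gt_eqF.
Qed.

End Constants.

(** * Local minimality through a slice transversal to scaling *)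

Section LocalMinimum.
Variables (R : realType) (k : R) (k0 : 0 < k).
Variables (f : 'rV[R]_6 -> R) (g : 'I_6 -> 'rV[R]_6 -> R) (a b c : R).
Local Notation x := (equal_length k).
Hypothesis fd : \forall y \near x, is_diff y f (fun v => \sum_i g i y * v 0 i).
Hypothesis gd : forall i,
  is_diff x (g i) (fun v => \sum_j edge_mx a b c i j * v 0 j).
Hypothesis gx0 : forall i, g i x = 0.
Hypothesis f_scale : forall (r : R) y, 0 < r -> met y -> f (r *: y) = f y.
Hypotheses (amb0 : 0 < a - b) (ab0 : 0 < a + b).

(** On the hyperplane of sum 0 the form is at least [m] times the square of the sup norm, [m] being
    the smaller of the two positive eigenvalues. Half of this absorbs a Taylor error of [m / 4]
    times that square. *)
Lemma local_min_transversal : \forall v \near (0 : 'rV[R]_6),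
  \sum_i (v : 'rV[R]_6) 0 i = 0 -> f x <= f (x + v).
Proof.
pose m := Num.min (a - b) (a + b).
have m0 : 0 < m by rewrite lt_min amb0.
have e0 : 0 < m / 4 by rewrite divr_gt0.
apply: filterS (critical_taylor2 fd gd gx0 e0) => v tv S0.
have q1 : m * \sum_i v 0 i ^+ 2 <= quad_form (edge_mx a b c) v.
  by apply: quad_form_edge_mx_ge => //; rewrite /m ge_min lexx ?orbT.
have vn : `|v| ^+ 2 <= \sum_i v 0 i ^+ 2.
  have [->|v0] := eqVneq v 0.
    by rewrite normr0 expr0n; apply: sumr_ge0 => i _; exact: sqr_ge0.
  have /mx_norm_neq0[[i j] /= vE] : mx_norm v != 0 by rewrite -normr_eq0 in v0.
  rewrite [`|v|]vE ord1 real_normK ?num_real // (bigD1 j) //=.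
  by rewrite lerDl; apply: sumr_ge0 => l _; exact: sqr_ge0.
have q2 : m * `|v| ^+ 2 <= quad_form (edge_mx a b c) v.
  by apply: le_trans q1; rewrite ler_pM2l.
have n0 : 0 <= m * `|v| ^+ 2 by rewrite mulr_ge0 ?exprn_ge0 // ltW.
move: tv; rewrite ler_norml => /andP[lo _].
move: lo q2 n0; rewrite mulrAC; set n := m * _; lra.
Qed.

(* Metrics near x are rescaled into the hyperplane of total length 6 k. *)
Lemma scale_invariant_local_min : local_min_on (@met R) f x.
Proof.
split; first exact: equal_met.
pose h (y : 'rV[R]_6) := (6 * k / total_length y) *: y - x.
have L0 : total_length x != 0 by rewrite equal_total_length mulf_neq0 // gt_eqF.
have hx : h x = 0.
  by rewrite /h equal_total_length divff ?scale1r ?subrr // mulf_neq0 // gt_eqF.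
have sc : {for (x : 'rV[R]_6), continuous (fun y => 6 * k / total_length y)}.
  have dL := is_diff_scalef (6 * k) (is_diff_invf L0 (is_diff_total_length x)).
  exact: (differentiable_continuous (@ex_diff _ _ _ _ _ _ _ dL)).
have idc : {for (x : 'rV[R]_6), continuous (fun y : 'rV[R]_6 => y)} by exact: cvg_id.
have xc : {for (x : 'rV[R]_6), continuous (fun=> x : 'rV[R]_6)} by exact: cst_continuous.
have hc : {for (x : 'rV[R]_6), continuous h} by exact: (continuousB (continuousZ sc idc) xc).
have near0 : \forall v \near h x, \sum_i (v : 'rV[R]_6) 0 i = 0 -> f x <= f (x + v).
  by rewrite hx; exact: local_min_transversal.
have := hc _ near0; rewrite nbhs_filterE /=.
apply: filterS => y hy yM.
have Ly := total_length_gt0 yM.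
have ky : 0 < 6 * k / total_length y by rewrite divr_gt0 // mulr_gt0.
(* The rescaled metric is [x + h y], and the coordinates of [h y] add up to 6 k - 6 k = 0. *)
rewrite -(f_scale ky yM) -[X in _ <= f X](subrKC x) //; apply: hy.
rewrite /h (eq_bigr (fun i => 6 * k / total_length y * y 0 i - k)); last first.
  by move=> i _; rewrite !mxE.
rewrite sumrB -big_distrr /= -/(total_length y) divfK ?gt_eqF //.
by rewrite sumr_const card_ord -[X in _ - X]mulr_natl subrr.
Qed.

End LocalMinimum.

(** * Einstein metrics, Hessian eigenspaces, saddle points and local minima *)

Theorem theorem3p3 (R : realType) :
  [/\
    forall k : R, 0 < k ->
      L_Einstein (equal_length k) /\ V_Einstein (equal_length k),
    forall k : R, 0 < k ->
      let HL := hessian (@LEHR R) (equal_length k) in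
      let HV := hessian (@VEHR R) (equal_length k) in
      [/\ has_second_partials (@LEHR R) (equal_length k) /\
          has_second_partials (@VEHR R) (equal_length k),
          (eigenspace HL (lambda1_LEHR k) :=: V1 R)%MS /\
          (eigenspace HV (lambda1_VEHR k) :=: V1 R)%MS,
          (eigenspace HL (lambda2_LEHR k) :=: V2 R)%MS /\
          (eigenspace HV (lambda2_VEHR k) :=: V2 R)%MS &
          (eigenspace HL 0 :=: V0 R)%MS /\
          (eigenspace HV 0 :=: V0 R)%MS],
    [/\ forall l : 'rV[R]_6, met l ->
          (critical_point (@LEHR R) l <->
           exists2 k : R, 0 < k & l = equal_length k),
        forall l : 'rV[R]_6,
          L_Einstein l <-> (exists2 k : R, 0 < k & l = equal_length k) &
        forall k : R, 0 < k ->
          saddle_point_on (@met R) (@LEHR R) (equal_length k)] &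
    forall k : R, 0 < k ->
      local_min_on (@met R) (@VEHR R) (equal_length k)
  ].
Proof.
have near_L (k : R) (k0 : 0 < k) : \forall y \near (equal_length k : 'rV[R]_6),
    is_diff y (@LEHR R) (fun v => \sum_i grad_LEHR i y * v 0 i).
  by apply: filterS (met_near (equal_met k0)) => y; exact: is_diff_LEHR.
have near_V (k : R) (k0 : 0 < k) : \forall y \near (equal_length k : 'rV[R]_6),
    is_diff y (@VEHR R) (fun v => \sum_i grad_VEHR i y * v 0 i).
  by apply: filterS (met_near (equal_met k0)) => y; exact: is_diff_VEHR.
have r0 := sqrt2_gt0 R; have r1 := sqrt2_lt R; have th2 := curvature_gt2 R.
split=> [k k0|k k0 HL HV||k k0].
- split; first by apply/L_EinsteinP; exists k.
  have xM := equal_met k0; have dW := is_diff_total_volume xM.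
  split=> // [i|]; first exact/diff_derivable/(@ex_diff _ _ _ _ _ _ _ dW).
  have W0 := total_volume_gt0 xM.
  (* Each partial derivative of the volume W is W / (2 k), while K_e is the curvature angle times
     k. *)
  exists ((2 * pi - 2 * acos (1 / 3)) * (2 * k) / total_volume (equal_length k)).
  move=> e; rewrite (partial_is_diff e dW) /edge_curv equal_dihedral //.
  rewrite equal_log_dvolume // mxE; field.
  by rewrite !gt_eqF.
- have q0 : 0 < Num.sqrt 2 / (9 * k ^+ 2) by rewrite divr_gt0 // mulr_gt0 ?exprn_gt0.
  have gL := is_diff_grad_LEHR k0; have gV := is_diff_grad_VEHR k0.
  rewrite {}/HL {}/HV (is_diff_hessian (near_L _ k0) gL).
  rewrite (is_diff_hessian (near_V _ k0) gV).
  set q := Num.sqrt 2 / (9 * k ^+ 2) in q0 *.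
  rewrite lambda1_VEHR_root // lambda2_VEHR_root //.
  have u0 : 0 < (total_volume (equal_length k) `^ 3^-1)^-1 / k.
    by rewrite divr_gt0 // invr_gt0 powR_gt0 // total_volume_gt0 //; exact: equal_met.
  set u := _ / k in u0 *; set th := 2 * pi - _ in th2 *.
  have kN0 : k != 0 by rewrite gt_eqF.
  (* The Hessian of [LEHR] has a = - 2 q, b = - 4 q, c = q, hence the eigenvalues 2 q and - 6 q. *)
  have EL1 : lambda1_LEHR k = - (2 * q) - - (4 * q).
    by rewrite /lambda1_LEHR /q; field.
  have EL2 : lambda2_LEHR k = - (2 * q) + - (4 * q).
    by rewrite /lambda2_LEHR /q; field.
  have EV1 : u * (3 * th + 4 * Num.sqrt 2 / 3) =
     u * (5 * th - 4 * Num.sqrt 2 / 3) - u * (2 * th - 8 * Num.sqrt 2 / 3).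
    by field.
  have EV2 : u * (7 * th - 4 * Num.sqrt 2) =
     u * (5 * th - 4 * Num.sqrt 2 / 3) + u * (2 * th - 8 * Num.sqrt 2 / 3).
    by field.
  have L1 : - (2 * q) - - (4 * q) != 0 by apply: lt0r_neq0; lra.
  have L2 : - (2 * q) + - (4 * q) != 0 by apply: ltr0_neq0; lra.
  have L3 : - (4 * q) != 0 by apply: ltr0_neq0; lra.
  have L0 : - (2 * q) + - (4 * q) + 6 * q = 0 by ring.
  have V1N : u * (3 * th + 4 * Num.sqrt 2 / 3) != 0.
    by apply/lt0r_neq0/mulr_gt0 => //; lra.
  have V2N : u * (7 * th - 4 * Num.sqrt 2) != 0.
    by apply/lt0r_neq0/mulr_gt0 => //; lra.
  have V3N : u * (2 * th - 8 * Num.sqrt 2 / 3) != 0.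
    by apply/lt0r_neq0/mulr_gt0 => //; lra.
  have V0E : u * (5 * th - 4 * Num.sqrt 2 / 3) + u * (2 * th - 8 * Num.sqrt 2 / 3)
    + 6 * (u * (- (7 * th / 6) + 2 * Num.sqrt 2 / 3)) = 0 by field.
  rewrite EL1 EL2 EV1 EV2; rewrite EV1 in V1N; rewrite EV2 in V2N.
  split; split.
  + exact: is_diff_has_second_partials (near_L _ k0) gL.
  + exact: is_diff_has_second_partials (near_V _ k0) gV.
  + exact: eigenspace_edge_mx1.
  + exact: eigenspace_edge_mx1.
  + exact: eigenspace_edge_mx2.
  + exact: eigenspace_edge_mx2.
  + exact: eigenspace_edge_mx0.
  + exact: eigenspace_edge_mx0.
- split=> [l lM|l|k k0]; [exact: critical_LEHR|exact: L_EinsteinP|].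
  have xM := equal_met k0.
  have q0 : 0 < Num.sqrt 2 / (9 * k ^+ 2) by rewrite divr_gt0 // mulr_gt0 ?exprn_gt0.
  set q := Num.sqrt 2 / (9 * k ^+ 2) in q0 *.
  have gL := is_diff_grad_LEHR k0; have g0 := equal_grad_LEHR k0.
  have sgn := quad_form_sign (near_L _ k0) gL g0.
  pose H := edge_mx (- (2 * q)) (- (4 * q)) q.
  (* Eigenvectors of opposite sign: the form takes the values 2 q * 2 and - 6 q * 4, which exclude a
     maximum and a minimum respectively. *)
  pose v1 : 'rV[R]_6 := row ord0 (V1 R).
  pose v2 : 'rV[R]_6 := row ord0 (V2 R).
  have q1 : quad_form H v1 = 4 * q.
    rewrite quad_form_edge_mx !sum_edges_ord !rev_edge // ![v1 _ _]mxE.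
    by rewrite !span_rowsE //=; ring.
  have q2 : quad_form H v2 = - (24 * q).
    rewrite quad_form_edge_mx !sum_edges_ord !rev_edge // ![v2 _ _]mxE.
    by rewrite !span_rowsE //=; ring.
  split=> //; first by apply/critical_LEHR => //; exists k.
    move=> [_ mn]; have v2N : quad_form H v2 != 0.
      by rewrite q2; apply: ltr0_neq0; lra.
    have [y [ly yM]] := sgn _ v2 (filterI mn (met_near xM)) v2N.
    rewrite -/q -/H q2 nmulr_rgt0; last lra.
    by have := ly yM; lra.
  move=> [_ mx]; have v1N : quad_form H v1 != 0.
    by rewrite q1; apply: lt0r_neq0; lra.
  have [y [ly yM]] := sgn _ v1 (filterI mx (met_near xM)) v1N.
  rewrite -/q -/H q1 pmulr_rgt0; last lra.
  by have := ly yM; lra.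
- have u0 : 0 < (total_volume (equal_length k) `^ 3^-1)^-1 / k.
    by rewrite divr_gt0 // invr_gt0 powR_gt0 // total_volume_gt0 //; exact: equal_met.
  apply: (scale_invariant_local_min k0 (near_V _ k0) (is_diff_grad_VEHR k0)
     (equal_grad_VEHR k0)).
  + by move=> r y r0' yM; exact: VEHR_scale.
  + by rewrite -mulrBr mulr_gt0 //; lra.
  + by rewrite -mulrDr mulr_gt0 //; lra.
Qed.
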